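(* Let $R$ be a Noetherian $\mathbb{N}$-graded ring, $M$ a finitely generated $\mathbb{Z}$-graded $R$-module, and $I$ a homogeneous ideal of $R$. Suppose $I$ is generated by homogeneous elements $y_1,\dots,y_c$ of degree $d_1,\dots,d_c$, respectively. Then the following hold: (1) Let $\mathfrak{p} \in \mathcal{A}_M(I) \smallsetminus \mathrm{Ass}_R(0:_M I)$. Then $\mathfrak{p} \in \mathcal{B}_M(I)$. Moreover, there exist $a_{\mathfrak{p}} \in \{d_1,\dots,d_c\}$ and $b_{\mathfrak{p}} \in \mathbb{Z}$ such that $$v_{\mathfrak{p}}(M/I^nM) = v_{\mathfrak{p}}(I^{n-1}M/I^nM) = a_{\mathfrak{p}} n + b_{\mathfrak{p}} \quad \text{for all } n \gg 0.$$ (2) Let $\mathfrak{p} \in \mathcal{A}_M(I) \cap \mathrm{Ass}_R(0:_M I)$. If $d_i \geq 1$ for $1 \leq i \leq c$, then $$v_{\mathfrak{p}}(M/I^nM) = v_{\mathfrak{p}}(M) = v_{\mathfrak{p}}(0:_M I) \quad \text{for all } n \gg 0.$$ (3) Let $(0:_M I) \neq 0$. Then $v(M/I^nM) \leq v(0:_M I)$ for all $n \gg 0$. Furthermore, if $d_i \geq 1$ for $1 \leq i \leq c$, then $$v(M/I^nM) = v(0:_M I) \quad \text{for all } n \gg 0.$$ (4) Let $(0:_M I) = 0$ and $\mathcal{A}_M(I) \neq \emptyset$. Then $$v(M/I^nM) = v(I^{n-1}M/I^nM) \quad \text{for all } n \gg 0,$$ and this function agrees for all $n \gg 0$ with a linear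 function $an+b$ of $n$ whose leading coefficient $a$ lies in $\{d_1,\dots,d_c\}$ (and $b \in \mathbb{Z}$).
   Context: Rings are commutative; $\mathbb{N}$ includes $0$. $(0:_M I) := \{x\in M : Ix=0\}$. It is known that $\mathrm{Ass}_R(M/I^nM)$ and $\mathrm{Ass}_R(I^{n-1}M/I^nM)$ are independent of $n$ for $n \gg 0$; their stable values are denoted $\mathcal{A}_M(I)$ and $\mathcal{B}_M(I)$, respectively. For a finitely generated $\mathbb{Z}$-graded $R$-module $L$ with $n$th graded component $L_n$ and $\mathfrak{p}\in\mathrm{Ass}_R(L)$, the local Vasconcelos invariant (local $v$-number) of $L$ at $\mathfrak{p}$ is $v_{\mathfrak{p}}(L) := \inf\{n : \mathfrak{p} = (0:_R x) \text{ for some } x \in L_n\}$. The Vasconcelos invariant ($v$-number) of $L$ is $v(L) := \inf\{v_{\mathfrak{p}}(L) : \mathfrak{p}\in\mathrm{Ass}_R(L)\}$, with the convention $v(0)=\infty$. *)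

(* Defs.v *)
From HB Require Import structures.
From mathcomp Require Import all_boot all_order all_algebra.
From mathcomp Require Import boolp classical_sets filter constructive_ereal.

Set Implicit Arguments.
Unset Strict Implicit.
Unset Printing Implicit Defensive.

Import Order.TTheory GRing.Theory Num.Theory.

Local Open Scope ring_scope.
Local Open Scope quotient_scope.
Local Open Scope classical_set_scope.

Section Submodules.
Variables (R : comPzRingType) (L : lmodType R).

Definition submodule (N : set L) : Prop := submod_closed [in N].

Definition generated (G : set L) : set L := smallest submodule G.

Definition finitely_generated (N : set L) : Prop :=
  exists s : seq L, N = generated [set` s].

(* The submodule I N, for an ideal I of R. *)
Definition smul (I : set R) (N : set L) : set L :=
  generated [set r *: x | r in I & x in N].

(* (0 :_L I) *)
Definition annihilated (I : set R) : set L :=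
  [set x | forall r, I r -> r *: x = 0].

(* (0 :_R x) *)
Definition ann (x : L) : set R := [set r | r *: x = 0].

Lemma generated_submodule (G : set L) : submodule (generated G).
Proof.
split; first by rewrite inE => N [[N0 _] _]; move: N0; rewrite inE.
move=> a u v; rewrite !inE => Gu Gv N [subN GN].
have /set_mem := subN.2 a u v (mem_set (Gu N (conj subN GN)))
  (mem_set (Gv N (conj subN GN))).
exact.
Qed.

End Submodules.

Arguments annihilated {R} L I _.

Section Ideals.
Variable R : comPzRingType.

(* Ideals are the submodules of R as a module R^o over itself. *)
Definition ideal (J : set R) : Prop := submodule (J : set R^o).

Definition ideal_generated (G : set R) : set R := generated (G : set R^o).

Definition ideal_pow (J : set R) (n : nat) : set R :=
  iter n (fun K : set R => smul J (K : set R^o)) setT.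

Definition prime_ideal (p : set R) : Prop :=
  [/\ ideal p, ~ p 1 & forall a b, p (a * b) -> p a \/ p b].

Definition noetherian : Prop :=
  forall J : set R, ideal J -> finitely_generated (J : set R^o).

End Ideals.

(* V is the internal direct sum of the additive subgroups G i. *)
Definition direct_sum (T : eqType) (V : zmodType) (G : T -> set V) : Prop :=
  [/\ forall i, zmod_closed [in G i],
      forall x, exists (s : seq T) (f : T -> V),
        (forall i, G i (f i)) /\ x = \sum_(i <- s) f i
    & forall (s : seq T) (f : T -> V), uniq s -> (forall i, G i (f i)) ->
        \sum_(i <- s) f i = 0 -> forall i, i \in s -> f i = 0].

(* 1 \in RG 0 is a consequence of these axioms. *)
Definition graded_ring (R : comPzRingType) (RG : nat -> set R) : Prop :=
  direct_sum RG /\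
  forall i j a b, RG i a -> RG j b -> RG (i + j)%N (a * b).

Definition graded_module (R : comPzRingType) (RG : nat -> set R)
    (L : lmodType R) (LG : int -> set L) : Prop :=
  direct_sum LG /\
  forall (i : nat) (j : int) a x, RG i a -> LG j x -> LG (i%:Z + j) (a *: x).

Definition homogeneous_ideal (R : comPzRingType) (RG : nat -> set R)
    (J : set R) : Prop :=
  exists2 S : set R, S `<=` \bigcup_i RG i & J = ideal_generated S.

Section QuotientModule.
Variables (R : comPzRingType) (L : lmodType R) (N : set L).
Hypothesis subN : submodule N.

Definition submod_pred (_ : submodule N) : {pred L} := [in N].

Fact submod_pred_closed : submod_closed (submod_pred subN).
Proof. exact: subN. Qed.

HB.instance Definition _ :=
  GRing.isSubmodClosed.Build R L (submod_pred subN) submod_pred_closed.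

Definition quotmod : Type := Quotient.quot (submod_pred subN).

HB.instance Definition _ := GRing.Zmodule.on quotmod.
HB.instance Definition _ := EqQuotient.on quotmod.

Definition to_quotmod (x : L) : quotmod := \pi x.

Lemma to_quotmodP x y : to_quotmod x = to_quotmod y <-> N (x - y).
Proof.
have E := Quotient.idealrBE (submod_pred subN) x y.
split=> [/eqP|Nxy].
  by rewrite /to_quotmod -E => /set_mem.
by apply/eqP; rewrite /to_quotmod -E; apply/mem_set.
Qed.

Lemma to_quotmod_surj z : exists x, to_quotmod x = z.
Proof. by exists (repr z); rewrite /to_quotmod reprK. Qed.

Lemma to_quotmodD x y : to_quotmod (x + y) = to_quotmod x + to_quotmod y.
Proof. by rewrite /to_quotmod !piE. Qed.

Definition quotmod_scale (a : R) (z : quotmod) : quotmod :=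
  to_quotmod (a *: repr z).

Lemma quotmod_scaleE a x :
  quotmod_scale a (to_quotmod x) = to_quotmod (a *: x).
Proof.
apply/to_quotmodP; rewrite -scalerBr; apply: set_mem.
rewrite -[_ *: _]addr0; apply: subN.2; last exact: subN.1.
by apply: mem_set; apply/to_quotmodP; rewrite /to_quotmod reprK.
Qed.

Lemma quotmod_scaleA a b z :
  quotmod_scale a (quotmod_scale b z) = quotmod_scale (a * b) z.
Proof.
by case: (to_quotmod_surj z) => x <-; rewrite !quotmod_scaleE scalerA.
Qed.

Lemma quotmod_scale1 : left_id 1 quotmod_scale.
Proof.
by move=> z; case: (to_quotmod_surj z) => x <-; rewrite quotmod_scaleE scale1r.
Qed.

Lemma quotmod_scaleDr : right_distributive quotmod_scale +%R.
Proof.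
move=> a z t; case: (to_quotmod_surj z) => x <-.
case: (to_quotmod_surj t) => y <-.
by rewrite -to_quotmodD !quotmod_scaleE scalerDr to_quotmodD.
Qed.

Lemma quotmod_scaleDl z :
  {morph quotmod_scale^~ z : a b / a + b}.
Proof.
move=> a b; case: (to_quotmod_surj z) => x <-.
by rewrite !quotmod_scaleE scalerDl to_quotmodD.
Qed.

HB.instance Definition _ := GRing.Zmodule_isLmodule.Build R quotmod
  quotmod_scaleA quotmod_scale1 quotmod_scaleDr quotmod_scaleDl.

Lemma to_quotmod_is_linear : linear to_quotmod.
Proof. by move=> a x y; rewrite to_quotmodD -quotmod_scaleE. Qed.

HB.instance Definition _ :=
  GRing.isLinear.Build R L quotmod *:%R to_quotmod to_quotmod_is_linear.

(* The grading of L / N induced by a grading of L (N being homogeneous). *)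
Definition quot_grading (LG : int -> set L) : int -> set quotmod :=
  fun k => to_quotmod @` LG k.

End QuotientModule.

Arguments to_quotmod {R L N} subN x.
Arguments quot_grading {R L N} subN LG.

(* A submodule N of L is regarded as a module; if N is homogeneous for the
   grading LG of L, its graded components are the N `&` LG n. The module L
   itself is setT. *)
Section Vasconcelos.
Variables (R : comPzRingType) (L : lmodType R).

Definition Ass (N : set L) : set (set R) :=
  [set p | prime_ideal p /\ exists2 x, N x & p = ann x].

Definition vloc (LG : int -> set L) (N : set L) (p : set R) : \bar int :=
  infimum +oo%E
    [set n%:E%E | n in [set n : int | exists2 x, (N `&` LG n) x & p = ann x]].

(* infimum +oo set0 = +oo, so that vnum LG N = +oo when N is zero. *)
Definition vnum (LG : int -> set L) (N : set L) : \bar int :=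
  infimum +oo%E [set vloc LG N p | p in Ass N].

End Vasconcelos.

(* The value F n for all n >> 0; set0 is a dummy for the case, excluded for the
   sequences below, where F is not eventually constant. *)
Definition stable_value (U : Type) (F : nat -> set U) : set U :=
  xget set0 [set P | \forall n \near \oo, F n = P].

Section Powers.
Variables (R : comPzRingType) (M : lmodType R) (I : set R).

(* I^n M *)
Definition powmod (n : nat) : set M := smul (ideal_pow I n) setT.

Lemma powmod_submodule n : submodule (powmod n).
Proof. exact: generated_submodule. Qed.

(* M / I^n M *)
Definition Mquot (n : nat) : lmodType R := quotmod (powmod_submodule n).

(* I^(n-1) M / I^n M, as a submodule of M / I^n M, for n >= 1 *)
Definition Mstep (n : nat) : set (Mquot n) :=
  to_quotmod (powmod_submodule n) @` powmod n.-1.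

Arguments Mstep : clear implicits.

Definition calA : set (set R) := stable_value (fun n => Ass [set: Mquot n]).

Definition calB : set (set R) := stable_value (fun n => Ass (Mstep n)).

Definition vloc_quot (MG : int -> set M) (n : nat) (p : set R) : \bar int :=
  vloc (quot_grading (powmod_submodule n) MG) setT p.

Definition vloc_step (MG : int -> set M) (n : nat) (p : set R) : \bar int :=
  vloc (quot_grading (powmod_submodule n) MG) (Mstep n) p.

Definition vnum_quot (MG : int -> set M) (n : nat) : \bar int :=
  vnum (quot_grading (powmod_submodule n) MG) setT.

Definition vnum_step (MG : int -> set M) (n : nat) : \bar int :=
  vnum (quot_grading (powmod_submodule n) MG) (Mstep n).

End Powers.

Arguments Mstep {R M} I n _.

(* Main.v *)
Require Import Defs.
From HB Require Import structures.
From mathcomp Require Import all_boot all_order all_algebra.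
From mathcomp Require Import zify.
From mathcomp Require Import boolp classical_sets filter constructive_ereal.

Set Implicit Arguments.
Unset Strict Implicit.
Unset Printing Implicit Defensive.

Import Order.TTheory GRing.Theory Num.Theory.

Local Open Scope ring_scope.
Local Open Scope classical_set_scope.

(** Everything is read off in M: the associated primes and v-numbers of M/I^nM and
I^nM/I^(n+1)M are expressed through the colon ideals (I^nM : x).  A family of
submodules U_n of M with I U_n in U_(n+1) is a graded module over the polynomial
ring in y_1, ..., y_c, and Hilbert's basis theorem for such families gives
(I^(n+1)M : I) = I^nM + (0 : I), with (0 : I) and I^nM independent, for n >> 0.
A homogeneous x with p = (I^(n+1)M : x) is then x' + z with x' in I^nM and Iz = 0;
unless p is the annihilator of z, x can be replaced by x'.  This compares M/I^(n+1)M
with I^nM/I^(n+1)M and, if all d_i are positive, with (0 : I), because I^nM then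
lives in large degrees.

For linearity, N_n = {x in I^nM : p x in I^(n+1)M} is such a family, and the x in N_n
with (I^(n+1)M : x) <> p form a graded submodule N'_n.  So the local v-number is the
least degree of a product of n - n0 of the y_i with one of finitely many homogeneous
generators of N_(n0) that is not in N'_n.  The words in the y_i that occur are closed
under deleting letters, and the minimal degree of words of length m in such a set is
eventually linear in m. *)

(** * Submodules, colon ideals and chain conditions *)

(** The variables act inside one fixed module, so an expression as a polynomial in y_1, ..., y_c is
    not unique; the basis theorem therefore uses a filtration by degree in the last variable and
    sets of possible leading coefficients. The formula for (I^(n+1)M : I) takes two rounds:
    Artin-Rees for x -> (y_1 x, ..., y_c x) only puts x' in I^(n+1-m)M, and a second finite
    generation argument removes the shift m. Because [stable_value] falls back on a dummy when a
    sequence does not settle, membership in [calB] requires a proof that Ass(I^nM/I^(n+1)M) settles: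
    these sets increase for large n and all lie in one finite set. N'_n is a submodule because p is
    prime: it consists of the x that some scalar outside p moves into I^(n+1)M. *)

Lemma nearP (Q : nat -> Prop) :
  (\forall n \near \oo, Q n) <-> exists N, forall n, (N <= n)%N -> Q n.
Proof.
by split=> [[N _ H]|[N H]]; exists N => //.
Qed.

Section Submodules.
Variables (R : comPzRingType) (L : lmodType R).
Implicit Types (N U : set L) (G : set L).

Lemma submoduleP N : submodule N <->
  N 0 /\ forall a u v, N u -> N v -> N (a *: u + v).
Proof.
split=> -[N0 NS]; split.
- by move: N0; rewrite inE.
- move=> a u v Nu Nv; have := NS a u v (mem_set Nu) (mem_set Nv).
  by rewrite inE.
- by rewrite inE.
- by move=> a u v; rewrite !inE; apply: NS.
Qed.

Lemma submodule0 N : submodule N -> N 0.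
Proof. by case/submoduleP. Qed.

Lemma submoduleZ N a u : submodule N -> N u -> N (a *: u).
Proof. by case/submoduleP => N0 NS Nu; rewrite -[_ *: _]addr0; apply: NS. Qed.

Lemma submoduleD N u v : submodule N -> N u -> N v -> N (u + v).
Proof.
by case/submoduleP => N0 NS Nu Nv; rewrite -[u]scale1r; apply: NS.
Qed.

Lemma submoduleN N u : submodule N -> N u -> N (- u).
Proof. by move=> sN Nu; rewrite -scaleN1r; apply: submoduleZ. Qed.

Lemma submoduleB N u v : submodule N -> N u -> N v -> N (u - v).
Proof. by move=> sN Nu Nv; apply: submoduleD => //; apply: submoduleN. Qed.

Lemma submoduleBK N u v : submodule N -> N (u - v) -> N v -> N u.
Proof. by move=> sN Nuv Nv; rewrite -(subrK v u); apply: submoduleD. Qed.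

Lemma submodule_sum N (T : Type) (s : seq T) (Q : pred T) (f : T -> L) :
  submodule N -> (forall i, Q i -> N (f i)) -> N (\sum_(i <- s | Q i) f i).
Proof.
move=> sN Nf; elim/big_ind: _ => //; first exact: submodule0.
by move=> *; apply: submoduleD.
Qed.

Lemma generated_min G N : submodule N -> G `<=` N -> generated G `<=` N.
Proof. by move=> sN GN x; apply. Qed.

Lemma sub_generated G : G `<=` generated G.
Proof. by move=> x Gx N [_]; apply. Qed.

Lemma generated_mono G G' : G `<=` G' -> generated G `<=` generated G'.
Proof.
move=> GG'; apply: generated_min; first exact: generated_submodule.
by move=> x /GG'; apply: sub_generated.
Qed.

Lemma generated_set0 : generated (set0 : set L) = [set 0].
Proof.
have sg := generated_submodule (set0 : set L).
apply/seteqP; split=> [|x ->]; last exact: submodule0 sg.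
apply: generated_min => //; apply/submoduleP; split=> //= a u v -> ->.
by rewrite scaler0 addr0.
Qed.

Lemma submodule_set0 : submodule [set (0 : L)].
Proof. by rewrite -generated_set0; apply: generated_submodule. Qed.

Lemma submodule_setT : submodule [set: L].
Proof. exact/submoduleP. Qed.

Lemma submoduleI N U : submodule N -> submodule U -> submodule (N `&` U).
Proof.
move=> sN sU; apply/submoduleP; split; first by split; apply: submodule0.
by move=> a u v [? ?] [? ?]; split; apply: submoduleD => //; apply: submoduleZ.
Qed.

Lemma smul_submodule Y U : submodule (smul Y U).
Proof. exact: generated_submodule. Qed.

Lemma smul_in (Y : set R) U a u : Y a -> U u -> smul Y U (a *: u).
Proof. by move=> Ya Uu; apply: sub_generated; exists a => //; exists u. Qed.

Lemma smul_min (Y : set R) U N : submodule N ->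
  (forall a u, Y a -> U u -> N (a *: u)) -> smul Y U `<=` N.
Proof.
by move=> sN H; apply: generated_min => // _ [a Ya [u Uu <-]]; apply: H.
Qed.

End Submodules.

(** * Colon ideals and primes *)

Section Colons.
Variables (R : comPzRingType) (L : lmodType R).
Implicit Types (N U : set L).

Lemma smul_ideal_generated (Y : set R) U : submodule U ->
  smul (ideal_generated Y) U = smul Y U.
Proof.
move=> sU; apply/seteqP; split; apply: smul_min; try exact: smul_submodule.
- have sYU := smul_submodule Y U.
  move=> a u Ya Uu; pose K := [set a : R^o | smul Y U (a *: u)].
  have sK : submodule K.
    apply/(@submoduleP R R^o); split=> [|b v w]; rewrite /K /=.
      by rewrite scale0r; apply: submodule0.
    move=> bY wY; rewrite scalerDl -scalerA.
    exact: submoduleD sYU (submoduleZ b sYU bY) wY.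
  by apply: (Ya K); split=> // b Yb; apply: smul_in.
- by move=> a u Ya Uu; apply: smul_in => //; apply: sub_generated.
Qed.

Definition colon N (x : L) : set R := [set r | N (r *: x)].

Lemma colon_ideal N x : submodule N -> ideal (colon N x).
Proof.
move=> sN; apply/(@submoduleP R R^o); rewrite /colon /=; split=> [|a u v uN vN].
  by rewrite scale0r; apply: submodule0.
by rewrite scalerDl -scalerA; apply: submoduleD => //; apply: submoduleZ.
Qed.

Lemma colon_submodule (J : set R) N : submodule N ->
  submodule [set x | J `<=` colon N x].
Proof.
move=> sN; apply/submoduleP; split=> [a _|a u v uJ vJ b Jb] /=.
  by rewrite /colon /= scaler0; apply: submodule0.
rewrite /colon /= scalerDr scalerA mulrC -scalerA.
by apply: submoduleD => //; [apply: submoduleZ => //; apply: uJ | apply: vJ].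
Qed.

Lemma annihilated_submodule (J : set R) : submodule (annihilated L J).
Proof. exact: (@colon_submodule J _ (@submodule_set0 R L)). Qed.

(** The class of [x] spans a copy of the domain R/p in L/N, where every nonzero element has
    annihilator [p]. *)
Lemma colon_prime_scale (N : set L) (p : set R) s x :
  submodule N -> prime_ideal p -> p = colon N x -> ~ p s -> p = colon N (s *: x).
Proof.
move=> sN pp px ps; apply/seteqP; split=> r; rewrite /colon /= scalerA => pr.
  by rewrite mulrC -scalerA; apply: submoduleZ => //; rewrite px in pr.
have: p (r * s) by rewrite px.
by case: pp => _ _ ppM /ppM[].
Qed.

(** A prime containing a finite intersection of ideals contains one of them. If all fail, the
    product of scalars outside [p], one for each index, lies in the intersection but not in [p]. *)
Lemma prime_colon_family (N : set L) (p : set R) (J : eqType) (s : seq J) f :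
  submodule N -> prime_ideal p -> (forall j, p `<=` colon N (f j)) ->
  (forall a, (forall j, j \in s -> N (a *: f j)) -> p a) ->
  exists2 j, j \in s & p = colon N (f j).
Proof.
move=> sN [ip p1 pM] pf sp; apply: contrapT => no.
suff [a pa Ha] : exists2 a, ~ p a & forall j, j \in s -> N (a *: f j).
  exact/pa/sp.
have {sp} : forall j, j \in s -> exists2 a, ~ p a & N (a *: f j).
  move=> j js; apply: contrapT => no'; apply: no; exists j => //.
  apply/seteqP; split=> // a fa; apply: contrapT => pa; apply: no'; by exists a.
elim: s {no} => [|j s IH] H; first by exists 1.
have [a pa Ha] := H j (mem_head _ _).
have [|b pb Hb] := IH; first by move=> k ks; apply: H; rewrite inE ks orbT.
exists (a * b); first by move/pM => [].
move=> k; rewrite inE => /orP[/eqP ->|ks].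
  by rewrite mulrC -scalerA; apply: submoduleZ.
by rewrite -scalerA; apply: submoduleZ => //; apply: Hb.
Qed.

End Colons.

(** * Ascending chains and Noetherian modules *)

Section Chains.

(** Dependent choice: without a maximal element, [next] iterates to an infinite [lt]-chain inside
    [Q]. *)
Lemma exists_maximal (T : Type) (lt : T -> T -> Prop) (Q : T -> Prop) (x0 : T) :
  (forall u : nat -> T, (forall n, Q (u n)) -> ~ forall n, lt (u n) (u n.+1)) ->
  Q x0 -> exists2 x, Q x & forall y, Q y -> ~ lt x y.
Proof.
move=> acc Qx0; apply: contrapT => nomax.
have next (x : {x | Q x}) : {y : {x | Q x} | lt (sval x) (sval y)}.
  apply: cid; apply: contrapT => no; apply: nomax.
  exists (sval x); first exact: (svalP x).
  by move=> y Qy ltxy; apply: no; exists (exist Q y Qy).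
pose u n := sval (iter n (fun x => sval (next x)) (exist Q x0 Qx0)).
apply: (acc u) => n; first exact: svalP.
exact: svalP (next _).
Qed.

Variables (R : comPzRingType) (L : lmodType R).

Definition noetherian_module : Prop :=
  forall N : set L, submodule N -> finitely_generated N.

Lemma chain_mono (U : nat -> set L) :
  (forall n, U n `<=` U n.+1) -> forall m n, (m <= n)%N -> U m `<=` U n.
Proof.
move=> Uinc m n /subnK <-; elim: (n - m)%N => // k IH.
by rewrite addSn; apply: subset_trans IH _.
Qed.

Lemma noetherian_acc (U : nat -> set L) : noetherian_module ->
  (forall n, submodule (U n)) -> (forall n, U n `<=` U n.+1) ->
  exists J, forall n, U n `<=` U J.
Proof.
move=> noeth sU Uinc.
have Umono := chain_mono Uinc.
have [|s Es] := noeth [set x | exists n, U n x].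
  apply/submoduleP; split=> [|a u v [m Um] [n Un]].
    by exists 0%N; apply: submodule0.
  exists (maxn m n); apply: submoduleD => //; first apply: submoduleZ => //.
    exact: Umono (leq_maxl _ _) _ Um.
  exact: Umono (leq_maxr _ _) _ Un.
have sU' : forall x, x \in s -> exists n, U n x.
  move=> x xs; suff: [set x | exists n, U n x] x by [].
  by rewrite Es; apply: sub_generated.
have [J HJ] : exists J, forall x, x \in s -> U J x.
  elim: s {Es} sU' => [|x s IH] H; first by exists 0%N.
  have [n Un] := H x (mem_head _ _).
  have [|J HJ] := IH; first by move=> z zs; apply: H; rewrite inE zs orbT.
  exists (maxn n J) => z; rewrite inE => /orP[/eqP->|/HJ UJ].
    exact: Umono (leq_maxl _ _) _ Un.
  exact: Umono (leq_maxr _ _) _ UJ.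
exists J => n x Unx.
have: generated [set` s] x by rewrite -Es; exists n.
by apply: generated_min.
Qed.

Lemma finitely_generated_noetherian : noetherian R -> finitely_generated [set: L] ->
  noetherian_module.
Proof.
move=> noethR [s Es].
suff fg : forall N, submodule N -> N `<=` generated [set` s] ->
    finitely_generated N.
  by move=> N sN; apply: fg => //; rewrite -Es.
elim: s {Es} => [|x s IH] N sN Ns.
  exists [::]; apply/seteqP; split=> //.
  by apply: generated_min => // z; rewrite /= in_nil.
have sgs := generated_submodule [set` s].
have [t Et] : finitely_generated (N `&` generated [set` s]).
  by apply: IH; [exact: submoduleI | move=> ? []].
(* The ideal of coefficients of [x] in elements of [N], taken modulo the span of [s]. *)
pose J : set R := [set r | exists2 u, N u & generated [set` s] (u - r *: x)].
have [|rs Ers] := noethR J.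
  apply/(@submoduleP R R^o); split=> [|a r r' [u Nu Hu] [v Nv Hv]].
    by exists 0; [exact: submodule0 | rewrite scale0r subr0; exact: submodule0 sgs].
  exists (a *: u + v); first by apply: submoduleD => //; apply: submoduleZ.
  rewrite scalerDl -scalerA opprD addrACA -scalerBr.
  exact: submoduleD sgs (submoduleZ _ sgs Hu) Hv.
have lift r : {u | r \in rs -> N u /\ generated [set` s] (u - r *: x)}.
  apply: cid; case: (pselect (r \in rs)) => rsr; last by exists 0.
  have : J r by rewrite Ers; apply: sub_generated.
  by case=> u; exists u.
pose ns := [seq sval (lift r) | r <- rs].
exists (ns ++ t); apply/seteqP; split; last first.
  apply: generated_min => // z; rewrite /= mem_cat => /orP[/mapP[r rsr ->]|zt].
    by have [] := svalP (lift r) rsr.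
  by have: generated [set` t] z by [apply: sub_generated]; rewrite -Et => -[].
move=> u Nu; set K := generated _.
have sK : submodule K := generated_submodule _.
(* Every coefficient in [J] is realised by an element of [K]; subtracting it from [u] leaves an
   element of [N] in the span of [s], which [t] generates. *)
have HJ : J `<=` [set r : R^o | exists2 v, (N `&` K) v & generated [set` s] (v - r *: x)].
  rewrite Ers; apply: (@generated_min R R^o) => [|r rsr].
    apply/(@submoduleP R R^o); split=> [|a r r' [w [Nw Kw] Hw] [v [Nv Kv] Hv]].
      exists 0; last by rewrite scale0r subr0; exact: submodule0 sgs.
      by split; [exact: submodule0 | exact: submodule0 sK].
    exists (a *: w + v).
      split; first exact: submoduleD sN (submoduleZ _ sN Nw) Nv.
      exact: submoduleD sK (submoduleZ _ sK Kw) Kv.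
    rewrite scalerDl -scalerA opprD addrACA -scalerBr.
    exact: submoduleD sgs (submoduleZ _ sgs Hw) Hv.
  have [Nl gl] := svalP (lift r) rsr; exists (sval (lift r)) => //; split=> //.
  by apply: sub_generated; rewrite /= mem_cat map_f.
have [r Hr] : exists r, generated [set` s] (u - r *: x).
  have: generated [set` x :: s] u by apply: Ns.
  apply: (@generated_min _ _ _
    [set w | exists r, generated [set` s] (w - r *: x)]) => [|z /=].
    apply/submoduleP; split=> [|a w v [r Hr] [r' Hr']].
      by exists 0; rewrite scale0r subr0; exact: submodule0 sgs.
    exists (a * r + r'); rewrite scalerDl -scalerA opprD addrACA -scalerBr.
    exact: submoduleD sgs (submoduleZ _ sgs Hr) Hr'.
  rewrite inE => /orP[/eqP->|zs]; [exists 1 | exists 0].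
    by rewrite scale1r subrr; exact: submodule0 sgs.
  by rewrite scale0r subr0; apply: sub_generated.
have [|v [Nv Kv] Hv] := HJ r; first by exists u.
apply: (submoduleBK sK) Kv.
have: (N `&` generated [set` s]) (u - v).
  split; first exact: submoduleB.
  rewrite (_ : u - v = (u - r *: x) - (v - r *: x)); first exact: submoduleB sgs Hr Hv.
  by rewrite opprB addrA subrK.
rewrite Et; apply: generated_mono => z zt /=; by rewrite mem_cat zt orbT.
Qed.

End Chains.

(** * Hilbert's basis theorem *)

Section GradedSystems.
Variables (R : comPzRingType) (V : lmodType R).
Hypothesis noethV : noetherian_module V.
Implicit Types (Y : set R) (U K L : nat -> set V).

(* A family U of submodules of V with Y (U n) in U n.+1 is the graded module
   \bigoplus_n U n over the polynomial ring with variables indexed by Y, acting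
   through multiplication by the elements of Y *)
Definition graded_system Y U : Prop :=
  (forall n, submodule (U n)) /\
  forall n a u, Y a -> U n u -> U n.+1 (a *: u).

Definition finite_system Y U : Prop :=
  exists n0, forall n, (n0 <= n)%N -> U n.+1 `<=` smul Y (U n).

Definition noetherian_system Y L : Prop :=
  forall U, graded_system Y U -> (forall n, U n `<=` L n) -> finite_system Y U.

(** The union [B] is generated from some degree [n0] on. In each of the finitely many degrees up to
    [n0] the chain stops because [V] is Noetherian, and multiplication by [Y] carries the common
    index [J] to higher degrees. *)
Lemma noetherian_system_acc Y L (A : nat -> nat -> set V) :
  noetherian_system Y L -> (forall j, graded_system Y (A j)) ->
  (forall j n, A j n `<=` L n) -> (forall j n, A j n `<=` A j.+1 n) ->
  exists J, forall j n, A j n `<=` A J n.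
Proof.
move=> noethL sA AL Ainc.
have Amono n j k : (j <= k)%N -> A j n `<=` A k n.
  exact: (@chain_mono _ _ (A ^~ n) (Ainc^~ n)).
pose B n := [set x | exists j, A j n x].
have sB : graded_system Y B.
  split=> [n|n a u Ya [j Au]]; last by exists j; apply: (sA j).2.
  apply/submoduleP; split=> [|a u v [j Au] [k Av]].
    by exists 0%N; apply: submodule0; exact: (sA 0%N).1.
  exists (maxn j k); have sAn := (sA (maxn j k)).1 n.
  apply: (submoduleD sAn); first apply: (submoduleZ _ sAn).
    exact: Amono (leq_maxl _ _) _ Au.
  exact: Amono (leq_maxr _ _) _ Av.
have [|n0 Hn0] := noethL B sB; first by move=> n x [j] /AL.
have [J HJ] : exists J, forall n, (n <= n0)%N -> forall j, A j n `<=` A J n.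
  elim: n0 {Hn0} => [|m [J HJ]].
    have [J HJ] := noetherian_acc noethV (fun j => (sA j).1 0%N) (Ainc^~ 0%N).
    by exists J => n; rewrite leqn0 => /eqP ->.
  have [J' HJ'] := noetherian_acc noethV (fun j => (sA j).1 m.+1) (Ainc^~ m.+1).
  exists (maxn J J') => n; rewrite leq_eqVlt ltnS => /orP[/eqP -> j|nm j].
    by apply: subset_trans (HJ' j) _; apply: Amono; apply: leq_maxr.
  by apply: subset_trans (HJ n nm j) _; apply: Amono; apply: leq_maxl.
exists J => j n x Ax.
have: B n x by exists j.
elim: n x {Ax} => [x [k Ax]|n IH x Bx]; first exact: HJ Ax.
have [nn0|n0n] := leqP n.+1 n0; first by case: Bx => k Ax; apply: HJ nn0 k x Ax.
have /= := Hn0 n n0n x Bx; apply: smul_min; first exact: (sA J).1.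
by move=> a u Ya Bu; apply: (sA J).2 => //; apply: IH.
Qed.

(* Hilbert's basis theorem, by induction on the number of variables: for the
   last variable z, U is controlled by the systems of leading coefficients, with
   respect to z, of its elements *)
Theorem hilbert_basis (ys : seq R) L :
  graded_system [set` ys] L -> finite_system [set` ys] L ->
  noetherian_system [set` ys] L.
Proof.
elim: ys L => [|z ys IHys] L sL [n0 Ln0] U sU UL.
  exists n0 => n /Ln0 Ln x /UL /Ln; apply: smul_min.
    exact: smul_submodule.
  by move=> a u; rewrite /= in_nil.
have Lys m u a : a \in ys -> L m u -> L m.+1 (a *: u).
  by move=> ays; apply: sL.2; rewrite /= inE ays orbT.
have Lz m u : L m u -> L m.+1 (z *: u) by apply: sL.2; rewrite /= mem_head.
have Uys m u a : a \in ys -> U m u -> U m.+1 (a *: u).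
  by move=> ays; apply: sU.2; rewrite /= inE ays orbT.
have Uz m u : U m u -> U m.+1 (z *: u) by apply: sU.2; rewrite /= mem_head.
(* [K] equals [L] up to degree [n0] and then grows by [ys] only: it contains the coefficients of the
   powers of [z], and the induction hypothesis applies to it. *)
pose K := fix K n := if n is m.+1
  then if (m < n0)%N then L m.+1 else smul [set` ys] (K m) else L 0%N.
have KS m : (n0 <= m)%N -> K m.+1 = smul [set` ys] (K m).
  by move=> n0m; rewrite /= ltnNge n0m.
have KL0 m : (m <= n0)%N -> K m = L m by case: m => //= m ->.
have sK0 m : submodule (K m).
  have [/KL0 ->|] := leqP m n0; first exact: sL.1.
  by case: m => // m n0m; rewrite KS //; exact: smul_submodule.
have Kys m u a : a \in ys -> K m u -> K m.+1 (a *: u).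
  move=> ays; have [n0m|mn0] := leqP n0 m; last first.
    by rewrite !KL0 // 1?ltnW //; apply: Lys.
  by rewrite KS // => Ku; apply: smul_in.
have sK : graded_system [set` ys] K by split=> // n a u /= ays; apply: Kys.
have noethK : noetherian_system [set` ys] K.
  by apply: IHys => //; exists n0 => n n0n; rewrite KS.
(* Coefficients of z^j in degree [n]; the test is needed because truncated subtraction would give
   [K 0] for [j] above [n]. *)
pose Kd j n := if (j <= n)%N then K (n - j)%N else [set 0].
have sKd j n : submodule (Kd j n).
  by rewrite /Kd; case: ifP => _; [exact: sK0 | exact: submodule_set0].
(* Elements of degree [n] that can be written as polynomials in [z] of degree less than [j] with
   coefficients in [K]. *)
pose F := fix F j n := if j is i.+1
  then [set x : V | exists2 k, Kd i n k & F i n (x - z ^+ i *: k)] else [set 0].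
have FS j n x : F j.+1 n x <-> exists2 k, Kd j n k & F j n (x - z ^+ j *: k) by [].
have sF j n : submodule (F j n).
  elim: j => [|j IH]; first exact: submodule_set0.
  apply/submoduleP; split=> [|a u v].
    by apply/FS; exists 0; [exact: submodule0 | rewrite scaler0 subr0; exact: submodule0 IH].
  move=> /FS[k Kk Fu] /FS[l Kl Fv]; apply/FS.
  exists (a *: k + l); first exact: submoduleD (sKd j n) (submoduleZ _ (sKd j n) Kk) Kl.
  rewrite scalerDr scalerA mulrC -scalerA opprD addrACA -scalerBr.
  exact: submoduleD IH (submoduleZ _ IH Fu) Fv.
have Finc j n : F j n `<=` F j.+1 n.
  move=> x Fx; apply/FS; exists 0; first exact: submodule0.
  by rewrite scaler0 subr0.
have Fys j n a u : a \in ys -> F j n u -> F j n.+1 (a *: u).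
  move=> ays; elim: j u => [|j IH] u; first by move=> /= ->; rewrite scaler0.
  move=> /FS[k Kk Fu]; apply/FS; exists (a *: k).
    move: Kk; rewrite /Kd; have [jn|nj] := leqP j n.
      by rewrite leqW // subSn //; apply: Kys.
    by move=> /= ->; rewrite scaler0; case: ifP => // _; exact: submodule0.
  by rewrite scalerA mulrC -scalerA -scalerBr; apply: IH.
have Fz j n u : F j n u -> F j.+1 n.+1 (z *: u).
  elim: j u => [|j IH] u.
    by move=> ->; rewrite scaler0; exact: submodule0.
  move=> /FS[k Kk Fu]; apply/FS; exists k.
    by move: Kk; rewrite /Kd ltnS subSS.
  by rewrite exprS -scalerA -scalerBr; apply: IH.
have LF n : L n `<=` F n.+1 n.
  elim: n => [|n IH].
    move=> x Lx; apply/FS; exists x; first by rewrite /Kd leqnn subnn.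
    by rewrite expr0 scale1r subrr.
  have [n0n|nn0] := leqP n0 n; last first.
    have F1 : F 1%N n.+1 `<=` F n.+2 n.+1.
      exact: (@chain_mono _ _ (F ^~ n.+1)).
    move=> x Lx; apply: F1; apply/FS; exists x.
      by rewrite /Kd leq0n subn0 KL0.
    by rewrite expr0 scale1r subrr.
  apply: subset_trans (Ln0 n n0n) _; apply: smul_min => // a u.
  rewrite /= inE => /orP[/eqP->|ays] /IH; first exact: Fz.
  by move=> Fu; apply: Finc; apply: Fys.
(* Possible leading coefficients of elements of [U] of degree [j] in [z]. They increase with [j], as
   one can multiply by [z]. *)
pose lt j m := [set k | K m k /\
  exists2 u, U (m + j)%N u & F j (m + j)%N (u - z ^+ j *: k)].
have slt j : graded_system [set` ys] (lt j).
  split=> [m|m a k /= ays [Kk [u Uu Fu]]]; last first.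
    split; first exact: Kys.
    exists (a *: u); first exact: Uys.
    by rewrite scalerA mulrC -scalerA -scalerBr; apply: Fys.
  have [sUm sFm] := (sU.1 (m + j)%N, sF j (m + j)%N).
  apply/submoduleP; split=> [|a k l [Kk [u Uu Fu]] [Kl [v Uv Fv]]].
    split; first exact: submodule0.
    by exists 0; [exact: submodule0 | rewrite scaler0 subr0; exact: submodule0].
  split; first exact: submoduleD (sK0 m) (submoduleZ _ (sK0 m) Kk) Kl.
  exists (a *: u + v); first exact: submoduleD sUm (submoduleZ _ sUm Uu) Uv.
  rewrite scalerDr scalerA mulrC -scalerA opprD addrACA -scalerBr.
  exact: submoduleD sFm (submoduleZ _ sFm Fu) Fv.
have ltinc j m : lt j m `<=` lt j.+1 m.
  move=> k [Kk [u Uu Fu]]; split=> //; exists (z *: u); rewrite addnS.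
    exact: Uz.
  by rewrite exprS -scalerA -scalerBr; apply: Fz.
have ltK j m : lt j m `<=` K m by move=> k [].
have [J HJ] := noetherian_system_acc noethK slt ltK ltinc.
have ltmono m j k : (j <= k)%N -> lt j m `<=` lt k m.
  exact: (@chain_mono _ _ (lt ^~ m) (ltinc^~ m)).
have [m0 Hm0] : exists m0, forall j, (j <= J)%N -> forall m, (m0 <= m)%N ->
    lt j m.+1 `<=` smul [set` ys] (lt j m).
  elim: (J) => [|i [m0 Hm0]].
    have [m0 H] := noethK (lt 0%N) (slt 0%N) (ltK 0%N).
    by exists m0 => j; rewrite leqn0 => /eqP->.
  have [m1 H] := noethK (lt i.+1) (slt i.+1) (ltK i.+1).
  exists (maxn m0 m1) => j; rewrite leq_eqVlt ltnS => ji m.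
  rewrite geq_max => /andP[m0m m1m].
  by case/orP: ji => [/eqP->|ji]; [exact: H | exact: Hm0].
(* For [j <= J] the coefficient degree [n - j] is then at least [m0], so [ys] generates the leading
   coefficients; for [j > J] a factor [z] can be split off. *)
exists (J + m0)%N => n Jn.
suff main j u : U n.+1 u -> F j n.+1 u -> smul [set` z :: ys] (U n) u.
  by move=> u Uu; apply: (main n.+2) => //; apply: LF; apply: UL.
have sS := smul_submodule [set` z :: ys] (U n).
have SU : smul [set` z :: ys] (U n) `<=` U n.+1.
  by apply: smul_min; [exact: sU.1 | move=> a v; apply: sU.2].
elim: j u => [|j IH] u Uu; first by move=> /= ->; exact: submodule0 sS.
move=> /FS[k Kk Fu].
(* It suffices to match the leading term of [u]: the difference has lower degree in [z]. *)
suff [w Sw Fw] : exists2 w, smul [set` z :: ys] (U n) w &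
    F j n.+1 (w - z ^+ j *: k).
  apply: (submoduleBK sS) (Sw); apply: IH.
    exact: submoduleB (sU.1 _) Uu (SU _ Sw).
  rewrite (_ : u - w = (u - z ^+ j *: k) - (w - z ^+ j *: k)).
    exact: submoduleB (sF j n.+1) Fu Fw.
  by rewrite opprB addrA subrK.
move: Kk; rewrite /Kd; have [jn Kk|nj ->] := leqP j n.+1; last first.
  by exists 0; [exact: submodule0 sS | rewrite scaler0 subr0; exact: submodule0].
have ltk : lt j (n.+1 - j)%N k.
  by split=> //; exists u; rewrite subnK.
have [Jj|jJ] := leqP j J; last first.
  (* By stabilisation at [J], the same leading coefficient occurs one power of [z] lower, for some
     [u'] in [U n]; take [w] to be [z *: u']. *)
  case: j jJ jn ltk {IH Fu Kk} => // j Jj jn ltk; rewrite subSS in ltk.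
  have [Kk [u' Uu' Fu']] := ltmono _ J j Jj _ (HJ j.+1 _ _ ltk).
  rewrite subnK // in Uu' Fu'.
  exists (z *: u'); first by apply: smul_in => //; rewrite /= mem_head.
  by rewrite exprS -scalerA -scalerBr; apply: Fz.
have jn' : (j <= n)%N by apply: leq_trans Jj (leq_trans (leq_addr _ _) Jn).
rewrite subSn // in ltk.
have m0nj : (m0 <= n - j)%N.
  by rewrite leq_subRL //; apply: leq_trans Jn; rewrite leq_add2r.
have H := Hm0 j Jj _ m0nj k ltk.
have: [set k | exists2 w, smul [set` z :: ys] (U n) w &
    F j n.+1 (w - z ^+ j *: k)] k; last by [].
apply: smul_min H; last first.
  move=> a l /= ays [Kl [w Uw Fw]]; rewrite subnK // in Uw Fw.
  exists (a *: w); first by apply: smul_in => //; rewrite /= inE ays orbT.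
  by rewrite scalerA mulrC -scalerA -scalerBr; apply: Fys.
apply/submoduleP; split=> [|a k1 k2 [w1 Sw1 Fw1] [w2 Sw2 Fw2]].
  by exists 0; [exact: submodule0 sS | rewrite scaler0 subr0; exact: submodule0].
exists (a *: w1 + w2); first exact: submoduleD sS (submoduleZ _ sS Sw1) Sw2.
rewrite scalerDr scalerA mulrC -scalerA opprD addrACA -scalerBr.
exact: submoduleD (sF _ _) (submoduleZ _ (sF _ _) Fw1) Fw2.
Qed.

End GradedSystems.

(** * Gradings *)

Section Components.
Variables (T : eqType) (V : zmodType) (G : T -> set V).
Hypothesis dsG : direct_sum G.

Let G_closed i : G i 0 /\ forall x y, G i x -> G i y -> G i (x - y).
Proof.
have [/(_ i)[G0 GB] _ _] := dsG; split; first by rewrite inE in G0.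
by move=> x y /mem_set Gx /mem_set Gy; have := GB _ _ Gx Gy; rewrite inE.
Qed.

Lemma graded0 i : G i 0. Proof. exact: (G_closed i).1. Qed.

Lemma gradedB i x y : G i x -> G i y -> G i (x - y).
Proof. exact: (G_closed i).2. Qed.

Lemma gradedN i x : G i x -> G i (- x).
Proof. by rewrite -sub0r; apply: gradedB; exact: graded0. Qed.

Lemma gradedD i x y : G i x -> G i y -> G i (x + y).
Proof. by move=> Gx /gradedN; rewrite -{2}[y]opprK; apply: gradedB. Qed.

Definition decomposition (x : V) (g : T -> V) : Prop :=
  (forall i, G i (g i)) /\
  exists s : seq T, [/\ uniq s, forall i, i \notin s -> g i = 0 &
    x = \sum_(i <- s) g i].

Lemma sum_support (s s' : seq T) (g : T -> V) : uniq s -> uniq s' ->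
  (forall i, i \notin s -> g i = 0) -> {subset s <= s'} ->
  \sum_(i <- s) g i = \sum_(i <- s') g i.
Proof.
move=> us us' g0 ss'; rewrite [RHS](bigID (mem s)) /= [X in _ + X]big1.
  rewrite addr0 -[RHS]big_filter; apply: perm_big; apply: uniq_perm => //.
    exact: filter_uniq.
  by move=> i; rewrite mem_filter /=; case: (boolP (i \in s)) => // /ss' ->.
by move=> i /g0.
Qed.

Lemma decomposition_exists x : exists g, decomposition x g.
Proof.
have [_ /(_ x)[s [f [Gf ->]]] _] := dsG.
(* The list given by [direct_sum] may repeat an index, so each summand is taken with its
   multiplicity. *)
exists (fun i => f i *+ count_mem i s); split.
  move=> i; elim: (count_mem i s) => [|n IH]; first by rewrite mulr0n; exact: graded0.
  by rewrite mulrS; exact: gradedD.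
exists (undup s); split; first exact: undup_uniq.
  by move=> i; rewrite mem_undup => /count_memPn ->.
rewrite -(big_undup_iterop_count _ s) /=; apply: eq_bigr => i _.
rewrite Monoid.iteropE; elim: (count_mem i s) => [|n IH] /=; first by rewrite mulr0n.
by rewrite mulrS IH.
Qed.

Lemma decomposition_uniq x g h : decomposition x g -> decomposition x h -> g =1 h.
Proof.
move=> [Gg [s [us sg xs]]] [Gh [t [ut th xt]]].
pose r := undup (s ++ t).
have ur : uniq r := undup_uniq _.
have sr : {subset s <= r} by move=> i si; rewrite mem_undup mem_cat si.
have tr : {subset t <= r} by move=> i ti; rewrite mem_undup mem_cat ti orbT.
have [_ _ /(_ r (fun i => g i - h i) ur)] := dsG => H i.
have [ir|] := boolP (i \in r); last first.
  by rewrite mem_undup mem_cat negb_or => /andP[/sg -> /th ->].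
apply/eqP; rewrite -subr_eq0; apply/eqP; apply: H => //.
  by move=> j; apply: gradedB.
by rewrite sumrB -(sum_support us ur) // -(sum_support ut ur) // -xs -xt subrr.
Qed.

Definition component x : T -> V := sval (cid (decomposition_exists x)).

Lemma componentP x : decomposition x (component x).
Proof. exact: svalP (cid _). Qed.

Lemma component_in x i : G i (component x i).
Proof. exact: (componentP x).1. Qed.

Lemma component_eq x g : decomposition x g -> component x =1 g.
Proof. exact/decomposition_uniq/componentP. Qed.

Lemma component_sum x : exists s : seq T,
  [/\ uniq s, forall i, i \notin s -> component x i = 0 &
    x = \sum_(i <- s) component x i].
Proof. exact: (componentP x).2. Qed.

Lemma componentD x y i : component (x + y) i = component x i + component y i.
Proof.
apply: (component_eq (g := fun i => component x i + component y i)).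
have [s [us sx xs]] := component_sum x; have [t [ut ty yt]] := component_sum y.
split=> [j|]; first by apply: gradedD; exact: component_in.
pose r := undup (s ++ t).
have ur : uniq r := undup_uniq _.
have sr : {subset s <= r} by move=> j sj; rewrite mem_undup mem_cat sj.
have tr : {subset t <= r} by move=> j tj; rewrite mem_undup mem_cat tj orbT.
exists r; split=> //.
  move=> j; rewrite mem_undup mem_cat negb_or => /andP[/sx -> /ty ->].
  by rewrite addr0.
by rewrite big_split /= -(sum_support us ur) // -(sum_support ut ur) // -xs -yt.
Qed.

Lemma component_homog k x i :
  G k x -> component x i = if i == k then x else 0.
Proof.
move=> Gx; apply: (component_eq (g := fun i => if i == k then x else 0)).
split=> [j|]; first by case: eqP => [->|_] //; exact: graded0.
exists [:: k]; rewrite big_seq1 eqxx; split=> // j.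
by rewrite inE => /negPf ->.
Qed.

Lemma component0 i : component 0 i = 0.
Proof. by rewrite (component_homog i (graded0 i)) eqxx. Qed.

Lemma component_bigsum (J : Type) (s : seq J) (f : J -> V) i :
  component (\sum_(j <- s) f j) i = \sum_(j <- s) component (f j) i.
Proof.
elim: s => [|j s IH]; first by rewrite !big_nil component0.
by rewrite !big_cons componentD IH.
Qed.

Lemma componentN x i : component (- x) i = - component x i.
Proof.
by apply/eqP; rewrite -addr_eq0 -componentD addNr component0.
Qed.

End Components.

(** * Homogeneous submodules and associated primes *)

Section GradedModule.
Variables (R : comPzRingType) (RG : nat -> set R).
Variables (M : lmodType R) (MG : int -> set M).
Hypothesis R_graded : graded_ring RG.
Hypothesis M_graded : graded_module RG MG.

Local Notation rcomp := (component R_graded.1).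
Local Notation mcomp := (component M_graded.1).

Lemma component_scale_homog i a x k :
  RG i a -> mcomp (a *: x) k = a *: mcomp x (k - i%:Z).
Proof.
move=> Ra; apply: (component_eq _ (g := fun k => a *: mcomp x (k - i%:Z))).
split=> [j|].
  rewrite -[X in MG X](subrKC i%:Z); apply: M_graded.2 => //.
  exact: component_in.
have [s [us sx xs]] := component_sum M_graded.1 x.
exists [seq i%:Z + j | j <- s]; split.
- by rewrite map_inj_uniq //; exact: addrI.
- move=> j; rewrite -{1}[j](subrKC i%:Z) mem_map; last exact: addrI.
  by move/sx ->; rewrite scaler0.
- rewrite big_map {1}xs scaler_sumr; apply: eq_bigr => j _.
  by rewrite addrAC subrr add0r.
Qed.

Definition homogeneous (N : set M) : Prop := forall x, N x -> forall k, N (mcomp x k).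

Definition homogeneous_elt (x : M) : Prop := exists k, MG k x.

(* Scalars have nonnegative degrees, so that the component of degree k of x only
   involves the generators of degree at most k. *)
Lemma generated_component (H N : set M) x k :
  H `<=` homogeneous_elt -> submodule N ->
  (forall h e, H h -> MG e h -> e <= k -> N h) ->
  generated H x -> N (mcomp x k).
Proof.
move=> Hh sN HN Hx.
suff: [set x | forall k', k' <= k -> N (mcomp x k')] x by apply.
apply: generated_min Hx => [|h Hh' k' k'k]; last first.
  have [e Ge] := Hh h Hh'; rewrite (component_homog _ _ Ge).
  case: eqP => [k'e|_]; last exact: submodule0.
  by apply: HN Hh' Ge _; rewrite -k'e.
apply/submoduleP; split=> [k' _|a u v Hu Hv k' k'k].
  by rewrite component0; exact: submodule0.
rewrite componentD; apply: (submoduleD sN); last exact: Hv.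
have [s [us _ ->]] := component_sum R_graded.1 a.
rewrite scaler_suml component_bigsum; apply: submodule_sum => // i _.
rewrite (@component_scale_homog i); last exact: component_in.
apply: (submoduleZ _ sN); apply: Hu; apply: le_trans k'k.
by rewrite lerBlDr lerDl.
Qed.

Lemma generated_homogeneous (H : set M) :
  H `<=` homogeneous_elt -> homogeneous (generated H).
Proof.
move=> Hh x Hx k; apply: generated_component Hx => //; first exact: generated_submodule.
by move=> h e Hh' _ _; exact: sub_generated.
Qed.

(** Contrapositive of [generated_component], as [x] is its own component of degree [k]. It shows
    that the least degree outside [N] is attained at a generator. *)
Lemma generated_homog_elt (H N : set M) x k :
  H `<=` homogeneous_elt -> submodule N -> generated H x -> MG k x -> ~ N x ->
  exists h e, [/\ H h, MG e h, e <= k & ~ N h].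
Proof.
move=> Hh sN Hx Gx Nx; apply: contrapT => no; apply: Nx.
have <- : mcomp x k = x by rewrite (component_homog _ _ Gx) eqxx.
apply: generated_component Hh sN _ Hx => h e Hh' Ge ek.
by apply: contrapT => Nh; apply: no; exists h, e.
Qed.

Lemma homogeneous_generators (N : set M) :
  submodule N -> homogeneous N -> finitely_generated N ->
  exists2 s : seq M, [set` s] `<=` homogeneous_elt & N = generated [set` s].
Proof.
move=> sN hN [s Es].
pose supp x := sval (cid (component_sum M_graded.1 x)).
have suppE x : x = \sum_(i <- supp x) mcomp x i.
  by have [] := svalP (cid (component_sum M_graded.1 x)).
pose t := [seq mcomp x i | x <- s, i <- supp x].
exists t.
  move=> _ /allpairsPdep[x [i [_ _ ->]]]; exists i; exact: component_in.
apply/seteqP; split.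
  rewrite {1}Es; apply: generated_min; first exact: generated_submodule.
  move=> x /= xs; rewrite [x]suppE big_seq.
  apply: submodule_sum; first exact: generated_submodule.
  move=> i ix; apply: sub_generated; apply/allpairsPdep; exists x, i; split=> //.
apply: generated_min => // _ /allpairsPdep[x [i [xs _ ->]]]; apply: hN.
by rewrite Es; apply: sub_generated.
Qed.

Lemma min_mem (s : seq int) : s != [::] ->
  exists2 m, m \in s & forall k, k \in s -> m <= k.
Proof.
elim: s => // a [_ _|b s IH _].
  by exists a; rewrite ?mem_head // => k; rewrite inE => /eqP ->.
have [//|m ms Hm] := IH.
have [am|/ltW ma] := leP a m.
  exists a; first exact: mem_head.
  by move=> k; rewrite inE => /orP[/eqP -> //|/Hm]; exact: le_trans.
exists m; first by rewrite inE ms orbT.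
by move=> k; rewrite inE => /orP[/eqP -> //|/Hm].
Qed.

(* The element x is chosen with as few components outside N as possible. *)
Lemma associated_prime_homogeneous (N L : set M) (p : set R) x :
  submodule N -> homogeneous N -> submodule L -> L x -> prime_ideal p ->
  p = colon N x -> forall r i, p r -> p (rcomp r i).
Proof.
move=> sN hN sL Lx pp px.
(* The list [s] covers the degrees in which [x] has a component outside [N]; the induction is on its
   size. *)
suff main n : forall x (s : seq int), (size s <= n)%N ->
    (forall k, k \notin s -> N (mcomp x k)) -> L x -> p = colon N x ->
    forall r i, p r -> p (rcomp r i).
  have [s [_ s0 _]] := component_sum M_graded.1 x.
  apply: (main (size s) x s) => // k /s0 ->; exact: submodule0.
elim: n {x Lx px} => [|n IH] x s sn sx Lx px.
  have s0 : s = [::] by apply/eqP; rewrite -size_eq0 -leqn0.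
  case: pp => _ p1 _; case: p1; rewrite px /colon /= scale1r.
  have [t [_ _ ->]] := component_sum M_graded.1 x.
  by apply: submodule_sum => // i _; apply: sx; rewrite s0.
have [s0|sn0] := eqVneq s [::].
  by apply: (IH x s) => //; rewrite s0.
have [m ms Hm] := min_mem sn0.
have ip : ideal p by case: pp.
move=> r i; elim/ltn_ind: i r => i IHi r pr.
apply: contrapT => npri.
have [t [ut t0 rt]] := component_sum R_graded.1 r.
pose r' := \sum_(j <- t | (i <= j)%N) rcomp r j.
have pr' : p r'.
  have -> : r' = r - \sum_(j <- t | ~~ (i <= j)%N) rcomp r j.
    by rewrite {1}rt (bigID (fun j => (i <= j)%N)) /= addrK.
  apply: (@submoduleB R R^o) => //; apply: (@submodule_sum R R^o) => // j.
  by rewrite -ltnNge => /IHi; apply.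
(* Multiplying [x] by the component of [r] outside [p] keeps the colon ideal [p]. If it also kills
   the lowest component modulo [N], fewer degrees remain and the induction hypothesis applies. *)
suff Nim : N (rcomp r i *: mcomp x m).
  have p' := colon_prime_scale sN pp px npri.
  pose s' := [seq i%:Z + k | k <- rem m s].
  apply: npri; apply: (IH (rcomp r i *: x) s') => //.
  - by rewrite size_map size_rem //; case: (size s) sn.
  - move=> k; rewrite (component_scale_homog _ _ (component_in R_graded.1 r i)) => ks'.
    have [-> //|km] := eqVneq (k - i%:Z) m.
    apply: submoduleZ => //; apply: sx; apply: contra ks' => ks.
    apply/mapP; exists (k - i%:Z); last by rewrite subrKC.
    have := ks; rewrite (perm_mem (perm_to_rem ms)) inE (negPf km) //.
  - exact: submoduleZ.
(* In degree [i + m] of [r' *: x], the terms with [j > i] involve components of [x] of degree below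
   [m], which lie in [N]. *)
have := pr'; rewrite {1}px /colon /= => /hN/(_ (i%:Z + m)).
rewrite scaler_suml -big_filter component_bigsum big_filter.
have [it|/t0 ->] := boolP (i \in t); last by rewrite scale0r => _; exact: submodule0.
rewrite big_mkcond.
rewrite (bigD1_seq i) //= leqnn (component_scale_homog _ _ (component_in R_graded.1 r i)).
rewrite addrAC subrr add0r => H.
set S := \sum_(j <- t | _) _ in H.
suff NS : N S by have := submoduleB sN H NS; rewrite addrK.
apply: submodule_sum => // j ji; case: ifP => [ij|_]; last exact: submodule0.
rewrite (component_scale_homog _ _ (component_in R_graded.1 r j)).
apply: submoduleZ => //; apply: sx; apply/negP => /Hm.
by rewrite addrAC lerDr subr_ge0 lez_nat leqNgt ltn_neqAle ij eq_sym ji.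
Qed.

(** As [p] is homogeneous, it is the intersection of the colon ideals of the finitely many
    components of [x], hence equal to one of them. *)
Lemma associated_prime_homog_elt (N L : set M) (p : set R) x :
  submodule N -> homogeneous N -> submodule L -> homogeneous L -> L x ->
  prime_ideal p -> p = colon N x ->
  exists k x', [/\ L x', MG k x' & p = colon N x'].
Proof.
move=> sN hN sL hL Lx pp px.
have hp := associated_prime_homogeneous sN hN sL Lx pp px.
have [s [us s0 xs]] := component_sum M_graded.1 x.
have [||k ks pk] := @prime_colon_family _ _ N p _ s (mcomp x) sN pp.
- move=> k r pr; rewrite /colon /=; have [t [_ _ ->]] := component_sum R_graded.1 r.
  rewrite scaler_suml; apply: submodule_sum => // i _.
  have := hp r i pr; rewrite px /colon /= => /hN/(_ (i%:Z + k)).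
  by rewrite (component_scale_homog _ _ (component_in R_graded.1 r i)) addrAC subrr add0r.
- move=> a Ha; rewrite px /colon /= xs scaler_sumr big_seq.
  by apply: submodule_sum.
exists k, (mcomp x k); split=> //; [exact: hL | exact: component_in].
Qed.

End GradedModule.

(** * Powers of an ideal *)

Section FiniteFamilies.
Variables (R : comPzRingType) (M : lmodType R) (c : nat).

Definition unit_family (i : 'I_c) (x : M) : {ffun 'I_c -> M} :=
  [ffun j => if j == i then x else 0].

Lemma unit_family_sum (f : {ffun 'I_c -> M}) : f = \sum_i unit_family i (f i).
Proof.
apply/ffunP => j; rewrite sum_ffunE (bigD1 j) //= ffunE eqxx big1 ?addr0 //.
by move=> i ij; rewrite ffunE eq_sym (negPf ij).
Qed.

Lemma ffun_finitely_generated : finitely_generated [set: M] ->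
  finitely_generated [set: {ffun 'I_c -> M}].
Proof.
move=> [s Es]; pose t := [seq unit_family i g | i <- enum 'I_c, g <- s].
exists t; apply/seteqP; split=> // f _.
have sK := generated_submodule [set` t]; set K := generated _ in sK *.
rewrite [f]unit_family_sum; apply: submodule_sum => // i _.
have: [set: M] (f i) by [].
rewrite Es => Hf; suff: [set x | K (unit_family i x)] (f i) by [].
apply: generated_min Hf => [|g gs]; last first.
  by apply: sub_generated; apply/allpairsP; exists (i, g); rewrite mem_enum.
apply/submoduleP; split=> [|a u v Ku Kv] /=.
  rewrite (_ : unit_family i 0 = 0); first exact: submodule0 sK.
  by apply/ffunP => j; rewrite !ffunE; case: ifP.
rewrite (_ : unit_family _ _ = a *: unit_family i u + unit_family i v).
  exact: submoduleD sK (submoduleZ _ sK Ku) Kv.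
by apply/ffunP => j; rewrite !ffunE; case: ifP => //; rewrite scaler0 addr0.
Qed.

End FiniteFamilies.

Section Powers.
Variables (R : comPzRingType) (M : lmodType R) (I : set R) (c : nat).
Variable y : 'I_c -> R.
Hypothesis noethR : noetherian R.
Hypothesis fgM : finitely_generated [set: M].
Hypothesis y_generates : I = ideal_generated (range y).

Local Notation P := (@powmod R M I).
Local Notation Y := (range y).

Lemma powmod0 : P 0%N = setT.
Proof.
apply/seteqP; split=> // x _; rewrite -[x]scale1r.
exact: (@smul_in R M setT setT).
Qed.

(** Makes [P] a graded system for the finitely many [y i], generated in degree 0. *)
Lemma powmodS n : P n.+1 = smul Y (P n).
Proof.
rewrite -smul_ideal_generated -?y_generates; last exact: powmod_submodule.
have sS := smul_submodule I (P n).
apply/seteqP; split; apply: smul_min => //; try exact: powmod_submodule.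
- move=> r x Ir _; pose K := [set r : R^o | forall x : M, smul I (P n) (r *: x)].
  suff: K r by apply.
  suff: smul I (ideal_pow I n : set R^o) `<=` K by apply.
  apply: (@smul_min R R^o) => [|a b Ia Jb z]; last first.
    rewrite -[_ *: z]scalerA; apply: smul_in => //; exact: smul_in.
  apply/(@submoduleP R R^o); split=> [z|a u v Ku Kv z].
    by rewrite scale0r; exact: submodule0 sS.
  by rewrite scalerDl -scalerA; exact: submoduleD sS (submoduleZ _ sS (Ku z)) (Kv z).
- move=> a u Ia Pu.
  suff: [set u | P n.+1 (a *: u)] u by [].
  have sP := @powmod_submodule R M I n.+1.
  apply: smul_min Pu => [|b x Jb _].
    apply/submoduleP; split=> [|b v w Pv Pw] /=.
      by rewrite scaler0; exact: submodule0 sP.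
    rewrite scalerDr scalerA mulrC -scalerA; exact: submoduleD sP (submoduleZ _ sP Pv) Pw.
  rewrite /= scalerA; apply: smul_in => //; exact: (@smul_in R R^o).
Qed.

Lemma powmod_decr1 n : P n.+1 `<=` P n.
Proof.
rewrite powmodS; apply: smul_min; first exact: powmod_submodule.
by move=> a u _; apply: submoduleZ; exact: powmod_submodule.
Qed.

Lemma powmod_decr m n : (m <= n)%N -> P n `<=` P m.
Proof.
move/subnK <-; elim: (n - m)%N => // k IH; rewrite addSn.
exact: subset_trans (powmod_decr1 (n := _)) IH.
Qed.

Lemma range_codom : Y = [set` codom y].
Proof.
by apply/seteqP; split=> [_ [i _ <-]|_ /codomP[i ->]]; [exact: codom_f | exists i].
Qed.

Lemma ideal_range_sub (J : set R) : ideal J -> Y `<=` J -> I `<=` J.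
Proof. by rewrite y_generates; apply: (@generated_min R R^o). Qed.

Lemma ideal_range_in i : I (y i).
Proof. by rewrite y_generates; apply: (@sub_generated R R^o); exists i. Qed.

Lemma powmod_in n a x : I a -> P n x -> P n.+1 (a *: x).
Proof.
move=> Ia Px; suff: I `<=` colon (P n.+1) x by apply.
apply: ideal_range_sub; first exact/colon_ideal/powmod_submodule.
by move=> b Yb; rewrite powmodS; apply: smul_in.
Qed.

Let noethM : noetherian_module M := finitely_generated_noetherian noethR fgM.

(** Truncated subtraction makes the terms up to index [m] all equal to M. The shifted family is an
    ambient system for families slightly larger than [P]. *)
Lemma powmod_shift_system m : graded_system Y (fun n => P (n - m)%N).
Proof.
split=> [n|n a u Ya Pu]; first exact: powmod_submodule.
have [mn|nm] := leqP m n; first by rewrite subSn // powmodS; apply: smul_in.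
by rewrite (eqP nm) powmod0.
Qed.

Lemma powmod_shift_finite m : finite_system Y (fun n => P (n - m)%N).
Proof. by exists m => n mn; rewrite subSn // powmodS. Qed.

Lemma powmod_shift_noetherian m : noetherian_system Y (fun n => P (n - m)%N).
Proof.
have := @powmod_shift_system m; have := @powmod_shift_finite m.
by rewrite range_codom; move=> *; apply: hilbert_basis.
Qed.

Let powmod_shift0 : (fun n => P (n - 0)%N) = P.
Proof. by apply/funext => n; rewrite subn0. Qed.

Lemma powmod_system : graded_system Y P.
Proof. by have := @powmod_shift_system 0%N; rewrite powmod_shift0. Qed.

Lemma powmod_noetherian : noetherian_system Y P.
Proof. by have := @powmod_shift_noetherian 0%N; rewrite powmod_shift0. Qed.

Lemma annihilatedP z : annihilated M I z <-> forall i, y i *: z = 0.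
Proof.
split=> [Iz i|yz a]; first exact/Iz/ideal_range_in.
suff: I `<=` colon [set 0] z by apply.
apply: ideal_range_sub; first exact/colon_ideal/submodule_set0.
by move=> _ [i _ <-]; apply: yz.
Qed.

(** The intersections of (0 : I) with I^nM form a system killed by every [y i], so finite generation
    makes them vanish for large n. *)
Lemma powmod_annihilated :
  exists n0, forall n, (n0 <= n)%N -> forall z, annihilated M I z -> P n z -> z = 0.
Proof.
have sP := @powmod_submodule R M I.
have [||n0 H] := @powmod_noetherian (fun n => annihilated M I `&` P n).
- split=> [n|n _ u [i _ <-] [/annihilatedP -> _]].
    by apply: submoduleI; [exact: annihilated_submodule | exact: sP].
  by split; apply: submodule0; [exact: annihilated_submodule | exact: sP].
- by move=> n z [].
exists n0.+1 => -[//|n] n0n z Iz Pz; have /= := H n n0n z (conj Iz Pz).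
apply: (smul_min (N := [set 0])); first exact: submodule_set0.
by move=> _ u [i _ <-] [/annihilatedP yu _]; exact: yu.
Qed.

(** The elements in question form a system [E], and Y E_n lies in I^(n+1)M by definition; finite
    generation puts E_(n+1) inside Y E_n. *)
Lemma powmod_colon_shift m : exists n0, forall n, (n0 <= n)%N -> forall x,
  P (n - m)%N x -> (forall i, P n.+1 (y i *: x)) -> P n x.
Proof.
have sP := @powmod_submodule R M I.
pose E n := [set x | P (n - m)%N x /\ forall i, P n.+1 (y i *: x)].
have [||n0 H] := @powmod_shift_noetherian m E.
- split=> [n|n _ u [i _ <-] [Pu yu]].
    have -> : E n = P (n - m)%N `&` [set x | Y `<=` colon (P n.+1) x].
      apply/seteqP; split=> x [Px Hx]; split=> //; first by move=> _ [i _ <-]; apply: Hx.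
      by move=> i; apply: Hx; exists i.
    by apply: submoduleI; [exact: sP | apply: colon_submodule; exact: sP].
  split=> [|j]; first by apply: powmod_decr (yu i); rewrite leq_subr.
  by rewrite powmodS; apply: smul_in; [exists j | exact: yu].
- by move=> n x [].
exists n0.+1 => -[//|n] n0n x Px yx; have /= := H n n0n x (conj Px yx).
by apply: smul_min => // _ u [i _ <-] [_ /(_ i)].
Qed.

(** Artin-Rees for the map [mul] from M to M^c, whose kernel is (0 : I): its image meets (I^nM)^c in
    a finitely generated system [U]. *)
Lemma powmod_colon_weak : exists m, forall n x,
  (forall i, P n.+1 (y i *: x)) ->
  exists2 x', P (n.+1 - m)%N x' & annihilated M I (x - x').
Proof.
have sP := @powmod_submodule R M I.
pose V := {ffun 'I_c -> M}.
have noethV : noetherian_module V :=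
  finitely_generated_noetherian noethR (ffun_finitely_generated c fgM).
pose L n := [set f : V | forall i, P n (f i)].
pose mul x : V := [ffun i => y i *: x].
pose U n := [set f : V | L n f /\ exists x, f = mul x].
have sL : graded_system Y L.
  split=> [n|n a u Ya Lu i]; last by rewrite !ffunE powmodS; apply: smul_in.
  apply/submoduleP; split=> [i|a u v Lu Lv i]; rewrite !ffunE; first exact: submodule0 (sP n).
  exact: submoduleD (sP n) (submoduleZ _ (sP n) (Lu i)) (Lv i).
have fL : finite_system Y L.
  exists 0%N => n _ f Lf; rewrite [f]unit_family_sum.
  have sYL := smul_submodule Y (L n).
  apply: submodule_sum => // i _; have := Lf i; rewrite powmodS.
  move=> Hf; suff: [set x | smul Y (L n) (unit_family i x)] (f i) by [].
  apply: smul_min Hf => [|a u Ya Pu] /=.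
    apply/submoduleP; split=> [|a u v Ku Kv] /=.
      rewrite (_ : unit_family i 0 = 0); first exact: submodule0 sYL.
      by apply/ffunP => j; rewrite !ffunE; case: ifP.
    rewrite (_ : unit_family _ _ = a *: unit_family i u + unit_family i v).
      exact: submoduleD sYL (submoduleZ _ sYL Ku) Kv.
    by apply/ffunP => j; rewrite !ffunE; case: ifP => //; rewrite scaler0 addr0.
  rewrite (_ : unit_family _ _ = a *: unit_family i u).
    by apply: smul_in => // j; rewrite ffunE; case: ifP => // _; exact: submodule0 (sP n).
  by apply/ffunP => j; rewrite !ffunE; case: ifP => //; rewrite scaler0.
have sU : graded_system Y U.
  split=> [n|n a u Ya [Lu [x Ex]]]; last first.
    split; first exact: sL.2.
    by exists (a *: x); apply/ffunP => i; rewrite Ex !ffunE !scalerA mulrC.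
  apply/submoduleP; split=> [|a u v [Lu [x Ex]] [Lv [x' Ex']]].
    split; first exact: submodule0 (sL.1 n).
    by exists 0; apply/ffunP => i; rewrite !ffunE scaler0.
  split; first exact: submoduleD (sL.1 n) (submoduleZ _ (sL.1 n) Lu) Lv.
  exists (a *: x + x'); apply/ffunP => i.
  by rewrite Ex Ex' !ffunE scalerDr !scalerA mulrC.
have [m Hm] : finite_system Y U.
  have sL' := sL; have fL' := fL; have sU' := sU; rewrite range_codom in sL' fL' sU' *.
  by apply: (hilbert_basis noethV sL' fL') => // n f [].
exists m => n x yx; have [nm|mn] := leqP n.+1 m.
  exists x; first by rewrite (eqP nm) powmod0.
  by rewrite subrr; exact: submodule0 (@annihilated_submodule R M I).
(* Each degree beyond [m] contributes one factor from [Y], which can be moved from the image to the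
   preimage. *)
suff main k f : U (m + k)%N f -> exists2 x', P k x' & f = mul x'.
  have [|x' Px' Ex'] := main (n.+1 - m)%N (mul x).
    split; last by exists x.
    by move=> i; rewrite ffunE subnKC // ltnW.
  exists x' => //; apply/annihilatedP => i.
  by have := congr1 (fun g : V => g i) Ex'; rewrite !ffunE scalerBr => ->; rewrite subrr.
elim: k f => [|k IH] f; first by rewrite powmod0 => -[_ [x' ->]]; exists x'.
rewrite addnS => /(Hm _ (leq_addr _ _)).
suff sK : submodule [set f : V | exists2 x', P k.+1 x' & f = mul x'].
  move=> Hf; apply: (smul_min sK) Hf => a u Ya /IH[x' Px' ->].
  exists (a *: x'); first by rewrite powmodS; apply: smul_in.
  by apply/ffunP => i; rewrite !ffunE !scalerA mulrC.
apply/submoduleP; split=> [|a u v [x1 P1 ->] [x2 P2 ->]].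
  by exists 0; [exact: submodule0 (sP _) | apply/ffunP => i; rewrite !ffunE scaler0].
exists (a *: x1 + x2); first exact: submoduleD (sP _) (submoduleZ _ (sP _) P1) P2.
by apply/ffunP => i; rewrite !ffunE scalerDr !scalerA mulrC.
Qed.

(** The [x'] of the weak form differs from [x] by an element of (0 : I), so it satisfies the same
    colon condition and [powmod_colon_shift] applies to it. *)
Lemma powmod_colon : exists n0, forall n, (n0 <= n)%N -> forall x,
  (forall i, P n.+1 (y i *: x)) ->
  exists2 x', P n x' & annihilated M I (x - x').
Proof.
have [m Hm] := powmod_colon_weak; have [n0 Hn0] := powmod_colon_shift m.
exists n0 => n n0n x yx; have [x' Px' Ix'] := Hm n x yx.
exists x' => //; apply: Hn0 => // [|i].
  by apply: powmod_decr Px'; apply: leq_sub2r.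
have := Ix'; move=> /annihilatedP/(_ i); rewrite scalerBr => /subr0_eq <-.
exact: yx.
Qed.

End Powers.

(** * Associated primes of the successive quotients *)

Section StepPrimes.
Variables (R : comPzRingType) (M : lmodType R) (I : set R) (c : nat).
Variable y : 'I_c -> R.
Hypothesis noethR : noetherian R.
Hypothesis fgM : finitely_generated [set: M].
Hypothesis y_generates : I = ideal_generated (range y).

Local Notation P := (@powmod R M I).
Local Notation Y := (range y).

Let noethM : noetherian_module M := finitely_generated_noetherian noethR fgM.

Definition step_primes n : set (set R) :=
  [set p | prime_ideal p /\ exists2 x, P n x & p = colon (P n.+1) x].

(** Maximality is over all indices at once: the colon ideals of all quotients are compared inside
    the Noetherian ring [R]. *)
Lemma exists_maximal_colon (K : nat -> set M) (m0 : nat) (x0 : M) (L : nat -> set M) :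
  (forall n, submodule (K n)) -> L m0 x0 -> ~ K m0 x0 ->
  exists m x, [/\ L m x, ~ K m x & forall n z, L n z -> ~ K n z ->
    colon (K m) x `<=` colon (K n) z -> colon (K m) x = colon (K n) z].
Proof.
move=> sK L0 K0.
have [||[m x] /= [Lx Kx] mx] := @exists_maximal (nat * M)%type
  (fun u v => colon (K u.1) u.2 `<=` colon (K v.1) v.2 /\
     ~ colon (K v.1) v.2 `<=` colon (K u.1) u.2)
  (fun u => L u.1 u.2 /\ ~ K u.1 u.2) (m0, x0).
- move=> u _ ltu.
  have [|n|J HJ] := @noetherian_acc R R^o (fun n => colon (K (u n).1) (u n).2) noethR.
  + by move=> n; apply: colon_ideal.
  + by case: (ltu n).
  + by case: (ltu J) => _; apply; apply: HJ.
- by [].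
exists m, x; split=> // n z Lz Kz le; apply/seteqP; split=> //.
by apply: contrapT => nle; apply: (mx (n, z)).
Qed.

(* A graded subsystem K between I P and P that is maximal among those whose
   associated primes form a finite set is P: otherwise it could be enlarged by the
   elements killed by a maximal colon ideal q of P/K, adding only the prime q. *)
Lemma step_primes_finite :
  exists Q : seq (set R), forall n p, step_primes n p -> p \in Q.
Proof.
have sP := @powmod_submodule R M I.
have sysP := powmod_system M y_generates.
pose fin (K : nat -> set M) := exists Q : seq (set R), forall n x p, K n x ->
  prime_ideal p -> p = colon (P n.+1) x -> p \in Q.
pose good K := [/\ graded_system Y K, forall n, P n.+1 `<=` K n,
  forall n, K n `<=` P n & fin K].
have [||K [sK PK KP [Q finK]] maxK] := @exists_maximal (nat -> set M)
  (fun K K' => (forall n, K n `<=` K' n) /\ ~ (forall n, K' n `<=` K n)) good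
  (fun n => P n.+1).
- move=> u gu ltu.
  have noethP := powmod_noetherian noethR fgM y_generates.
  have [|j n|j n|J HJ] := noetherian_system_acc noethM noethP (A := u).
  + by move=> j; case: (gu j).
  + by case: (gu j) => _ _ H _; exact: H.
  + by case: (ltu j) => H _; exact: H.
  + by case: (ltu J) => _; apply => n; apply: HJ.
- split=> //.
  + by split=> [n|n]; [exact: sP | exact: sysP.2].
  + by move=> n z.
  + exact: (powmod_decr1 y_generates).
  + exists [::] => n x p Px [_ p1 _] px; case: p1; rewrite px /colon /=.
    by rewrite scale1r.
suff PK' : forall n, P n `<=` K n.
  by exists Q => n p [pp [x Px px]]; apply: finK px => //; apply: PK'.
move=> n0 x0 P0; apply: contrapT => K0.
have [m [x [Px Kx mx]]] := exists_maximal_colon sK.1 P0 K0.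
set q := colon (K m) x in mx.
pose K' n := [set z | P n z /\ q `<=` colon (K n) z].
apply: (maxK K'); last first.
  split=> [n z Kz|K'K].
    by split=> [|a _]; [exact: KP | exact: submoduleZ (sK.1 n) Kz].
  by apply/Kx/K'K; split.
split.
- split=> [n|n a z Ya [Pz qz]].
    by apply: submoduleI; [exact: sP | apply: colon_submodule; exact: sK.1].
  split; first exact: sysP.2.
  by move=> b qb; rewrite /colon /= scalerA mulrC -scalerA; apply: sK.2 => //; exact: qz.
- move=> n z Pz; split; first exact: (powmod_decr y_generates (leqnSn n)) Pz.
  by move=> a _; apply: submoduleZ; [exact: sK.1 | exact: PK].
- by move=> n z [].
exists (q :: Q) => n z p [Pz qz] pp pz; rewrite inE.
have [Kz|Kz] := pselect (K n z); first by rewrite (finK n z p) ?orbT.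
have Eq := mx n z Pz Kz qz.
(* Either a multiple of [z] in [K] still has colon ideal [p], which is then in [Q], or [p] contains
   [(K n : z)], which is [q] by maximality. *)
have [[s ps Ks]|nos] := pselect (exists2 s, ~ p s & K n (s *: z)).
  have := colon_prime_scale (sP n.+1) pp pz ps.
  by move=> /(finK n (s *: z) p Ks pp) ->; rewrite orbT.
apply/orP; left; apply/eqP/seteqP; split=> a; rewrite Eq.
  by rewrite pz => Pa; apply: PK.
by move=> Ka; apply: contrapT => pa; apply: nos; exists a.
Qed.

(** If all [y i *: (a *: x)] lie in I^(n+2)M, then [a *: x] lies in I^(n+1)M. So [p] is the
    intersection of the colon ideals of the [y i *: x], hence one of them. *)
Lemma step_primes_increasing :
  exists n0, forall n, (n0 <= n)%N -> step_primes n `<=` step_primes n.+1.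
Proof.
have sP := @powmod_submodule R M I.
have [n0 H] := powmod_colon_shift noethR fgM y_generates 1.
exists n0 => n n0n p [pp [x Px px]].
have Pin a i : P n.+1 (a *: x) -> P n.+2 (a *: (y i *: x)).
  rewrite scalerA mulrC -scalerA; apply: (powmod_in y_generates) => //.
  exact: (ideal_range_in y_generates).
have [j a pa|a Ha|j _ pj] := @prime_colon_family _ _ (P n.+2) p _ (enum 'I_c)
    (fun i => y i *: x) (sP _) pp.
- by apply: Pin; rewrite px in pa.
- rewrite px /colon /=; apply: H => [||i]; first exact: leqW.
    by rewrite subn1 /=; exact: submoduleZ (sP n) Px.
  rewrite scalerA mulrC -scalerA; apply: Ha; by rewrite mem_enum.
split=> //; exists (y j *: x) => //; apply: (powmod_in y_generates) => //.
exact: (ideal_range_in y_generates).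
Qed.

Lemma step_primes_stable :
  exists n0, forall n, (n0 <= n)%N -> step_primes n = step_primes n0.
Proof.
have [Q HQ] := step_primes_finite; have [n0 Hn0] := step_primes_increasing.
have mono m n : (n0 <= m)%N -> (m <= n)%N -> step_primes m `<=` step_primes n.
  move=> n0m /subnK <-; elim: (n - m)%N => // k IH.
  apply: subset_trans IH _; rewrite addSn; apply: Hn0.
  exact: leq_trans n0m (leq_addl _ _).
have [J n0J HJ] : exists2 J, (n0 <= J)%N & forall n p, (n0 <= n)%N -> p \in Q ->
    step_primes n p -> step_primes J p.
  elim: Q {HQ} => [|q Q [J n0J HJ]]; first by exists n0.
  have [[m n0m qm]|noq] := pselect (exists2 m, (n0 <= m)%N & step_primes m q).
    exists (maxn m J); first exact: leq_trans n0J (leq_maxr _ _).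
    move=> n p n0n; rewrite inE => /orP[/eqP-> _|pQ pn].
      exact: mono (leq_maxl _ _) _ qm.
    exact: mono (leq_maxr _ _) _ (HJ n p n0n pQ pn).
  exists J => // n p n0n; rewrite inE => /orP[/eqP-> qn|]; last exact: HJ.
  by case: noq; exists n.
exists J => n Jn; apply/seteqP; split; last exact: mono.
by move=> p pn; exact: HJ (leq_trans n0J Jn) (HQ _ _ pn) pn.
Qed.

End StepPrimes.

(** * Minimal degrees of words *)

Section IntegerMinima.

Definition is_min (A : int -> Prop) (m : int) : Prop :=
  A m /\ forall k, A k -> m <= k.

Lemma is_min_exists (A : int -> Prop) (b k : int) :
  (forall k, A k -> b <= k) -> A k -> exists m, is_min A m.
Proof.
move=> Ab Ak; pose Q n := `[< A (b + n%:Z) >].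
have AQ j : A j -> exists2 n, Q n & j = b + n%:Z.
  move=> Aj; have : 0 <= j - b by rewrite subr_ge0 Ab.
  case E: (j - b) => [n|//] _.
  have jE : j = b + n%:Z by rewrite -E subrKC.
  by exists n => //; apply/asboolP; rewrite -jE.
have exQ : exists n, Q n by have [n Qn _] := AQ k Ak; exists n.
exists (b + (ex_minn exQ)%:Z); case: ex_minnP => m /asboolP Am mmin; split=> //.
by move=> j /AQ[n Qn ->]; rewrite lerD2l lez_nat; apply: mmin.
Qed.

Lemma bounded_nondecreasing_constant (g : nat -> int) (m0 : nat) (b : int) :
  (forall m, (m0 <= m)%N -> g m <= g m.+1) ->
  (forall m, (m0 <= m)%N -> g m <= b) ->
  exists m1, forall m, (m1 <= m)%N -> g m = g m1.
Proof.
move=> ginc gb.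
have mono m k : (m0 <= m)%N -> (m <= k)%N -> g m <= g k.
  move=> m0m /subnK <-; elim: (k - m)%N => // n IH; apply: le_trans IH _.
  by rewrite addSn; apply/ginc/(leq_trans m0m)/leq_addl.
have [||_ [[m1 m01 ->] m1min]] := @is_min_exists
  [set k | exists2 m, (m0 <= m)%N & k = - g m] (- b) (- g m0).
- by move=> _ [m m0m ->]; rewrite lerN2 gb.
- by exists m0.
exists m1 => m m1m; have m0m := leq_trans m01 m1m.
apply/eqP; rewrite eq_le (mono m1 m) // andbT -lerN2; apply: m1min.
by exists m.
Qed.

Lemma seq_bounds (J : eqType) (s : seq J) (e : J -> int) :
  exists a b, forall j, j \in s -> a <= e j <= b.
Proof.
elim: s => [|j s [a [b H]]]; first by exists 0, 0.
exists (Num.min a (e j)), (Num.max b (e j)) => k.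
rewrite inE => /orP[/eqP ->|/H /andP[ak kb]].
  by rewrite ge_min le_max !lexx !orbT.
by rewrite ge_min le_max ak kb.
Qed.

End IntegerMinima.

Section Words.
Variables (c : nat) (d : 'I_c -> nat).

Definition word_degree (w : seq 'I_c) : nat := \sum_(i <- w) d i.

Lemma word_sum (F : 'I_c -> nat) (w : seq 'I_c) :
  (\sum_(i <- w) F i = \sum_i count_mem i w * F i)%N.
Proof.
elim: w => [|j w IH]; first by rewrite big_nil big1.
rewrite big_cons IH; under [RHS]eq_bigr => i _ do rewrite /= mulnDl.
rewrite big_split /=; congr addn; rewrite (bigD1 j) //= eqxx mul1n big1 ?addn0 //.
by move=> i; rewrite eq_sym => /negPf ->.
Qed.

Lemma word_size (w : seq 'I_c) : (size w = \sum_i count_mem i w)%N.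
Proof.
by rewrite -sum1_size word_sum; apply: eq_bigr => i _; rewrite muln1.
Qed.

Lemma word_degree_nseq n i : word_degree (nseq n i) = (n * d i)%N.
Proof.
by elim: n => [|n IH]; rewrite /word_degree ?big_nil //= big_cons -/(word_degree _) IH.
Qed.

Variables (J : eqType) (H : seq J) (e : J -> int) (Q : seq 'I_c -> J -> Prop).
Hypothesis Q_H : forall w g, Q w g -> g \in H.
Hypothesis Q_rem : forall w g i, i \in w -> Q w g -> Q (rem i w) g.

(** Letters other than [i] are deleted first, then surplus copies of [i]. *)
Lemma subword_nseq w g i m : Q w g -> (m <= count_mem i w)%N -> Q (nseq m i) g.
Proof.
have [n sw] : exists n, size w = n by exists (size w).
elim: n w sw => [|n IH] w sw Qw.
  by move/size0nil: sw Qw => -> Qw; rewrite leqn0 => /eqP ->.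
have [/allP wi|] := boolP (all (pred1 i) w).
  have {}wi : w = nseq n.+1 i.
    by rewrite -sw; apply/all_pred1P; apply/allP.
  rewrite wi count_nseq /= eqxx mul1n leq_eqVlt => /orP[/eqP ->|mn].
    by rewrite -wi.
  apply: (IH (nseq n i)); rewrite ?size_nseq //.
    have := @Q_rem w g i; rewrite wi /= eqxx mem_head -[i :: _]/(nseq n.+1 i) -wi.
    exact.
  by rewrite count_nseq /= eqxx mul1n.
rewrite -has_predC => /hasP[j jw /= ji] mw; apply: (IH (rem j w)).
- by rewrite size_rem // sw.
- exact: Q_rem.
- by rewrite count_rem jw /= (negPf ji) subn0.
Qed.

Hypothesis Q_large : forall m, exists w g, (m <= size w)%N /\ Q w g.

Definition word_values m : int -> Prop := fun k => exists w g,
  [/\ size w = m, Q w g & k = (word_degree w)%:Z + e g].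

(* The slope is the least degree a of a letter i that occurs arbitrarily often. A
   long word of minimal degree contains such a letter of degree a; dropping it
   shows that min_m - a m is eventually nondecreasing, while the powers of i bound
   it from above. *)
Lemma word_values_min_linear : exists i (b : int) m0, forall m, (m0 <= m)%N ->
  is_min (word_values m) ((d i)%:Z * m%:Z + b).
Proof.
have [Emin [Emax HE]] := seq_bounds H e.
(* The letters outside [unb] occur at most [N0] times each, hence at most [c * N0] times together,
   in any admissible word. *)
pose unb i := forall N, exists w g, Q w g /\ (N <= count_mem i w)%N.
have bnd i : {N | ~ unb i -> forall w g, Q w g -> (count_mem i w <= N)%N}.
  apply: cid; have [ui|] := pselect (unb i); first by exists 0%N.
  move=> nui; apply: contrapT => no; apply: nui => N; apply: contrapT => no'.
  apply: no; exists N => _ w g Qw; rewrite leqNgt; apply/negP => Nw.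
  by apply: no'; exists w, g; split=> //; apply: ltnW.
pose N0 := (\max_i sval (bnd i))%N.
have HN0 i w g : ~ unb i -> Q w g -> (count_mem i w <= N0)%N.
  move=> ui Qw; apply: leq_trans (leq_bigmax i).
  exact: svalP (bnd i) ui w g Qw.
clearbody N0.
have [i1 ui1] : exists i, unb i.
  apply: contrapT => no; have [w [g [sw Qw]]] := Q_large (c * N0).+1.
  move: sw; rewrite ltnNge => /negP; apply; rewrite word_size.
  rewrite -[X in (_ <= X * _)%N]card_ord -sum_nat_const; apply: leq_sum => i _.
  by apply: HN0 Qw => ui; apply: no; exists i.
have : `[< unb i1 >] by apply/asboolP.
case/(@arg_minnP _ i1 (fun i => `[< unb i >]) d) => i /asboolP ui imin.
set a := d i in imin.
have unb_nseq m : exists2 g, Q (nseq m i) g & g \in H.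
  have [w [g [Qw mw]]] := ui m; exists g; last exact: Q_H Qw.
  exact: subword_nseq Qw mw.
have fE m : {k | is_min (word_values m) k}.
  apply: cid; have [g Qg gH] := unb_nseq m.
  apply: (@is_min_exists _ Emin ((word_degree (nseq m i))%:Z + e g)).
    move=> _ [w [h [_ Qw ->]]]; have /andP[Eh _] := HE h (Q_H Qw).
    by apply: le_trans Eh _; rewrite lerDr.
  by exists (nseq m i), g; split; rewrite ?size_nseq.
pose f m := sval (fE m).
have fP m : is_min (word_values m) (f m) := svalP (fE m).
pose g m := f m - a%:Z * m%:Z.
have gmax m : g m <= Emax.
  have [h Qh hH] := unb_nseq m; have /andP[_ Eh] := HE h hH.
  rewrite lerBlDl; apply: le_trans (_ : a%:Z * m%:Z + e h <= _); last by rewrite lerD2l.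
  apply: (fP m).2; exists (nseq m i), h; split; rewrite ?size_nseq //.
  by rewrite word_degree_nseq PoszM mulrC.
have [m0 Hm0] : exists m0, forall w h, Q w h -> (m0 <= size w)%N ->
    (word_degree w)%:Z + e h <= a%:Z * (size w)%:Z + Emax ->
    exists2 j, j \in w & d j = a.
  (* Without a letter of degree [a], all unbounded letters have degree at least [a + 1], so (a+1)|w|
     <= (a+1) c N0 + deg w. With deg w + Emin <= a|w| + Emax this bounds |w|. *)
  exists (a.+1 * (c * N0) + `|Emax - Emin|).+1%N => w h Qw sw le.
  apply: contrapT => no.
  have ge : (a.+1 * size w <= a.+1 * (c * N0) + word_degree w)%N.
    rewrite word_size /word_degree word_sum big_distrr /=.
    rewrite -[X in (_ <= _ * (X * _) + _)%N]card_ord -sum_nat_const big_distrr /=.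
    rewrite -big_split /=; apply: leq_sum => j _.
    have [uj|uj] := pselect (unb j); last first.
      by apply: leq_trans (leq_addr _ _); rewrite leq_mul2l (HN0 j w h).
    have [-> | cj] := posnP (count_mem j w); first by rewrite muln0.
    apply: leq_trans (leq_addl _ _); rewrite mulnC leq_mul2l; apply/orP; right.
    have aj : (a <= d j)%N by apply: imin; apply/asboolP.
    rewrite ltn_neqAle aj andbT; apply/eqP => daj; apply: no; exists j => //.
    by rewrite -has_pred1 has_count.
  have /andP[Eh _] := HE h (Q_H Qw).
  move: (word_degree w) (size w) ge le sw Eh => D S; lia.
have gdecr m : (m0 <= m.+1)%N -> g m <= g m.+1.
  move=> m0m; have [[w [h [sw Qw Ef]]] _] := fP m.+1.
  have [||j jw dj] := Hm0 w h Qw; first by rewrite sw.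
    by rewrite -Ef sw -lerBlDl; apply: gmax.
  have : f m <= (word_degree (rem j w))%:Z + e h.
    apply: (fP m).2; exists (rem j w), h; split=> //; last exact: Q_rem.
    by rewrite size_rem // sw.
  move: Ef; rewrite /g /word_degree (big_rem j) //= dj; lia.
have [m1 Hm1] := @bounded_nondecreasing_constant g m0 Emax
  (fun m m0m => gdecr m (leqW m0m)) (fun m _ => gmax m).
exists i, (g m1), m1 => m m1m.
by rewrite -(Hm1 m m1m) /g subrKC.
Qed.

End Words.

(** * Graded modules and powers of an ideal *)

Section GradedPowers.
Variables (R : comPzRingType) (RG : nat -> set R).
Variables (M : lmodType R) (MG : int -> set M).
Variables (I : set R) (c : nat) (y : 'I_c -> R) (d : 'I_c -> nat).
Hypothesis R_graded : graded_ring RG.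
Hypothesis R_noetherian : noetherian R.
Hypothesis M_graded : graded_module RG MG.
Hypothesis M_fg : finitely_generated [set: M].
Hypothesis y_homogeneous : forall i, RG (d i) (y i).
Hypothesis y_generates : I = ideal_generated (range y).

Local Notation P := (@powmod R M I).
Local Notation Y := (range y).
Local Notation mcomp := (component M_graded.1).
Local Notation homog := (homogeneous M_graded).
Local Notation homog_elt := (homogeneous_elt MG).

Let sP : forall n, submodule (P n) := @powmod_submodule R M I.
Let noethM : noetherian_module M := finitely_generated_noetherian R_noetherian M_fg.

Definition word_prod (w : seq 'I_c) : R := \prod_(i <- w) y i.

Definition word_multiples (H : set M) (m : nat) : set M :=
  [set x | exists w g, [/\ size w = m, H g & x = word_prod w *: g]].

Lemma word_prod_cons i w (x : M) : word_prod (i :: w) *: x = y i *: (word_prod w *: x).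
Proof. by rewrite /word_prod big_cons scalerA. Qed.

Lemma word_prod_rem i w (x : M) : i \in w ->
  word_prod w *: x = y i *: (word_prod (rem i w) *: x).
Proof. by move=> iw; rewrite /word_prod (big_rem i) //= scalerA. Qed.

Lemma word_prod_homog w k x :
  MG k x -> MG ((word_degree d w)%:Z + k) (word_prod w *: x).
Proof.
move=> Gx; elim: w => [|i w IH].
  by rewrite /word_degree /word_prod !big_nil add0r scale1r.
rewrite word_prod_cons /word_degree big_cons PoszD -addrA.
by apply: M_graded.2.
Qed.

Lemma word_prod_system (U : nat -> set M) w m x :
  graded_system Y U -> U m x -> U (m + size w)%N (word_prod w *: x).
Proof.
move=> sU Ux; elim: w => [|i w IH]; first by rewrite addn0 /word_prod big_nil scale1r.
by rewrite word_prod_cons addnS; apply: sU.2.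
Qed.

Lemma word_multiples_homog H m :
  H `<=` homog_elt -> word_multiples H m `<=` homog_elt.
Proof.
move=> Hh _ [w [g [_ /Hh[k Gg] ->]]].
by eexists; apply: word_prod_homog Gg.
Qed.

Lemma generated_word_multiples (U : nat -> set M) (H : set M) m :
  U 0%N `<=` generated H -> (forall n, U n.+1 `<=` smul Y (U n)) ->
  U m `<=` generated (word_multiples H m).
Proof.
move=> U0 US; elim: m => [|m IH].
  apply: subset_trans U0 _; apply: generated_mono => g Hg; exists [::], g; split=> //.
  by rewrite /word_prod big_nil scale1r.
have sG := generated_submodule (word_multiples H m.+1).
apply: subset_trans (US m) _; apply: smul_min => // _ u [i _ <-] /IH Gu.
suff: [set u | generated (word_multiples H m.+1) (y i *: u)] u by [].
apply: generated_min Gu => [|_ [w [g [sw Hg ->]]]]; last first.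
  apply: sub_generated; exists (i :: w), g; rewrite word_prod_cons /= sw; by split.
apply/submoduleP; split=> [|a v v' Gv Gv'] /=.
  by rewrite scaler0; exact: submodule0 sG.
by rewrite scalerDr scalerA mulrC -scalerA; exact: submoduleD sG (submoduleZ _ sG Gv) Gv'.
Qed.

Let gens : exists2 s : seq M, [set` s] `<=` homog_elt & [set: M] = generated [set` s].
Proof. exact: (homogeneous_generators (M_graded := M_graded) (submodule_setT M)). Qed.

Let P0 := powmod0 M I.
Let PS := powmodS M y_generates.

Lemma powmod_homogeneous n : homog (P n).
Proof.
have [s sh sT] := gens.
have -> : P n = generated (word_multiples [set` s] n).
  apply/seteqP; split.
    by apply: generated_word_multiples => [|m]; rewrite ?P0 ?sT // PS.
  apply: generated_min => // _ [w [g [<- _ ->]]]; rewrite -[size w]add0n.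
  by apply: (@word_prod_system P); [exact: powmod_system | rewrite P0].
by apply: (generated_homogeneous R_graded); exact: word_multiples_homog.
Qed.

Lemma set0_homogeneous : homog [set 0].
Proof. by move=> _ -> k; rewrite component0. Qed.

Lemma annihilated_homogeneous : homog (annihilated M I).
Proof.
move=> z /(annihilatedP y_generates) Iz k; apply/(annihilatedP y_generates) => i.
have := component_scale_homog M_graded z (k + (d i)%:Z) (y_homogeneous i).
by rewrite Iz component0 addrK.
Qed.

Lemma homog_degree_uniq k k' x : MG k x -> MG k' x -> x <> 0 -> k = k'.
Proof.
move=> Gx Gx' x0; apply: contrapT => kk'; apply: x0.
have := component_homog M_graded.1 k' Gx.
rewrite (component_homog M_graded.1 k' Gx') eqxx.
by case: eqP => // k'k; case: kk'.
Qed.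

(** Used with [D = 0] to bound the degrees of M below, and with [D = 1] to push I^nM into high
    degrees. *)
Lemma powmod_degree_bound (D : nat) : (forall i, (D <= d i)%N) ->
  exists b : int, forall n k x, P n x -> MG k x -> x <> 0 -> b + (D * n)%N%:Z <= k.
Proof.
move=> Dd; have [s sh sT] := gens.
pose e x := xget 0 [set k | MG k x].
have eP x : x \in s -> MG (e x) x.
  by move=> /sh[k Gx]; apply: (@xgetPex _ 0 [set k | MG k x]); exists k.
have [b [b' Hb]] := seq_bounds s e.
exists b => n k x Px Gx x0.
have Hx : generated (word_multiples [set` s] n) x.
  apply: generated_word_multiples Px => [|m]; rewrite ?P0 ?sT //.
  by rewrite PS.
have [h [e' [[w [g [<- gs Eh]]] Gh e'k h0]]] :=
  generated_homog_elt R_graded M_graded (word_multiples_homog sh) (@submodule_set0 R M) Hx Gx x0.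
apply: le_trans e'k.
have := word_prod_homog w (eP g gs); rewrite -Eh => /homog_degree_uniq/(_ Gh h0) <-.
rewrite addrC; apply: lerD; last by have /andP[] := Hb g gs.
rewrite lez_nat /word_degree -sum1_size big_distrr /=; apply: leq_sum => i _.
by rewrite muln1.
Qed.

Definition step_degrees n p : int -> Prop := fun k => exists x,
  [/\ P n x, MG k x & p = colon (P n.+1) x].

Lemma step_degrees_linear p :
  (exists n0, forall n, (n0 <= n)%N -> step_primes M I n p) ->
  exists i (b : int) n0, forall n, (n0 <= n)%N ->
    is_min (step_degrees n p) ((d i)%:Z * n%:Z + b).
Proof.
move=> [n0 Hn0]; have [pp [x0 Px0 px0]] := Hn0 n0 (leqnn _).
have [ip _ pM] := pp.
have hp := associated_prime_homogeneous R_graded (sP n0.+1)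
  (@powmod_homogeneous n0.+1) (sP n0) Px0 pp px0.
pose N n := [set x | P n x /\ p `<=` colon (P n.+1) x].
(* The kernel of localisation at [p] modulo I^(n+1)M; on [N n] its complement is exactly where the
   colon ideal equals [p]. *)
pose N' n := [set x | exists2 s, ~ p s & P n.+1 (s *: x)].
have sysP := powmod_system M y_generates.
have sysN : graded_system Y N.
  split=> [n|n a u Ya [Pu pu]].
    by apply: submoduleI; [exact: sP | apply: colon_submodule; exact: sP].
  split=> [|s ps]; first exact: sysP.2.
  by rewrite /colon /= scalerA mulrC -scalerA; apply: sysP.2 => //; exact: pu.
have sN' n : submodule (N' n).
  apply/submoduleP; split=> [|a u v [s ps Ps] [t pt Pt]].
    by exists 1; [case: pp | rewrite scaler0; exact: submodule0 (sP _)].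
  exists (s * t); first by move/pM => [].
  rewrite scalerDr; apply: (submoduleD (sP _)); last first.
    by rewrite -scalerA; exact: submoduleZ (sP _) Pt.
  rewrite mulrC !scalerA mulrAC -scalerA -[_ * a]mulrC -scalerA.
  rewrite scalerA; exact: submoduleZ (sP _) Ps.
have N'P n x : N n x -> p = colon (P n.+1) x <-> ~ N' n x.
  move=> [Px px]; split=> [Ep [s ps Ps]|nN']; first by apply: ps; rewrite Ep.
  by apply/seteqP; split=> // s Ps; apply: contrapT => ps; apply: nN'; exists s.
have hN n : homog (N n).
  move=> x [Px px] k; split=> [|r pr]; first exact: powmod_homogeneous.
  have [t [_ _ ->]] := component_sum R_graded.1 r.
  rewrite /colon /= scaler_suml; apply: submodule_sum => // i _.
  have := px _ (hp r i pr); rewrite /colon /=.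
  move=> /(@powmod_homogeneous n.+1)/(_ (k + i%:Z)).
  by rewrite (component_scale_homog M_graded x _ (component_in R_graded.1 r i)) addrK.
have [|n1 finN] := powmod_noetherian R_noetherian M_fg y_generates sysN.
  by move=> n x [].
have [H Hh HN] := homogeneous_generators (sysN.1 n1) (@hN n1) (noethM (sysN.1 n1)).
pose e x := xget 0 [set k | MG k x].
have eP x : x \in H -> MG (e x) x.
  by move=> /Hh[k Gx]; apply: (@xgetPex _ 0 [set k | MG k x]); exists k.
have NH x : x \in H -> N n1 x by move=> xH; rewrite HN; apply: sub_generated.
have genN m : N (n1 + m)%N `<=` generated (word_multiples [set` H] m).
  apply: (@generated_word_multiples (fun m => N (n1 + m)%N)).
    by rewrite addn0 HN.
  by move=> n; rewrite addnS; apply: finN; exact: leq_addr.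
pose Q w g := g \in H /\ ~ N' (n1 + size w)%N (word_prod w *: g).
have Q_H w g : Q w g -> g \in H by case.
have Q_rem w g i : i \in w -> Q w g -> Q (rem i w) g.
  move=> iw [gH Nw]; split=> // -[s ps Ps]; apply: Nw; exists s => //.
  have sw : size w = (size (rem i w)).+1.
    by rewrite size_rem //; case: (w) iw.
  rewrite (word_prod_rem _ iw) scalerA mulrC -scalerA sw addnS.
  by apply: sysP.2 => //; exists i.
have Q_large m : exists w g, (m <= size w)%N /\ Q w g.
  pose m' := maxn m n0.
  have [|_ [x Px Ex]] := Hn0 (n1 + m')%N.
    exact: leq_trans (leq_maxr m n0) (leq_addl _ _).
  have Nx : N (n1 + m')%N x by split=> //; rewrite -Ex.
  have N'x := (N'P _ _ Nx).1 Ex.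
  have [h Hh' N'h] : exists2 h, word_multiples [set` H] m' h & ~ N' (n1 + m')%N h.
    apply: contrapT => no; apply: N'x; apply: generated_min (genN _ _ Nx) => // h Hh'.
    by apply: contrapT => N'h; apply: no; exists h.
  have [w [g [sw gH Eh]]] := Hh'; exists w, g; rewrite sw leq_maxl; split=> //.
  by split=> //; rewrite sw -Eh.
have [i [b [m0 Hm0]]] := @word_values_min_linear c d M H e Q Q_H Q_rem Q_large.
(* Words of length [m] reach index [n1 + m], so the intercept is corrected by [d i * n1]. *)
exists i, (b - (d i)%:Z * n1%:Z), (n1 + m0)%N => n n1n.
have [m m0m ->] : exists2 m, (m0 <= m)%N & n = (n1 + m)%N.
  by exists (n - n1)%N; lia.
have -> : (d i)%:Z * (n1 + m)%N%:Z + (b - (d i)%:Z * n1%:Z) = (d i)%:Z * m%:Z + b by lia.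
have [[w [g [sw [gH N'w] E]]] lb] := Hm0 m m0m; split.
  rewrite sw in N'w; exists (word_prod w *: g).
  have Nw : N (n1 + m)%N (word_prod w *: g).
    by rewrite -sw; apply: word_prod_system => //; exact: NH.
  split; [by case: Nw | by rewrite E; apply: word_prod_homog; exact: eP |].
  exact/(N'P _ _ Nw).2.
move=> k [x [Px Gx Ex]].
have Nx : N (n1 + m)%N x by split=> //; rewrite -Ex.
have N'x := (N'P _ _ Nx).1 Ex.
have [h [e' [[v [h' [sv hH Eh]]] Gh e'k N'h]]] :=
  generated_homog_elt R_graded M_graded (word_multiples_homog Hh) (sN' _) (genN _ _ Nx) Gx N'x.
apply: le_trans e'k; apply: lb; exists v, h'; split=> //.
  by split=> //; rewrite sv -Eh.
have := word_prod_homog v (eP h' hH); rewrite -Eh => Gh'.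
apply: homog_degree_uniq Gh Gh' _ => h0; apply: N'h; rewrite h0; exact: submodule0 (sN' _).
Qed.

End GradedPowers.

(** * Infima and quotient modules *)

Section Infima.

Lemma infimum_eq (A : set (\bar int)) m :
  A m -> (forall a, A a -> (m <= a)%E) -> infimum +oo%E A = m.
Proof.
move=> Am mA; rewrite /infimum; case: eqVneq => [A0|_]; first by rewrite A0 in Am.
have infm : infimums A m by split=> [a|a]; [exact: mA | apply].
case: xgetP => [x _ [xA mx]|/(_ m)]; last by case.
by apply/eqP; rewrite eq_le xA // mx.
Qed.

Lemma infimum_fin (A : set int) m : is_min A m ->
  infimum +oo%E [set n%:E%E | n in A] = m%:E%E.
Proof.
move=> [Am mA]; apply: infimum_eq; first by exists m.
by move=> _ [k /mA mk <-]; rewrite lee_fin.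
Qed.

Lemma infimum_fin_ge (A : set int) m : (forall k, A k -> m <= k) ->
  (m%:E <= infimum +oo [set n%:E | n in A])%E.
Proof.
move=> mA; have [->|/set0P[k Ak]] := eqVneq A set0.
  by rewrite image_set0 /infimum eqxx leey.
have [j jmin] := is_min_exists mA Ak.
by rewrite (infimum_fin jmin) lee_fin; apply/mA/jmin.1.
Qed.

End Infima.

(** The element [p] rules out the dummy value [set0]. *)
Lemma stable_valueP (U : Type) (F : nat -> set U) p : stable_value F p ->
  exists N, forall n, (N <= n)%N -> F n = stable_value F.
Proof.
rewrite /stable_value; case: xgetP => [A _ /nearP[N H] _|_ []].
by exists N.
Qed.

Lemma stable_value_eq (U : Type) (F : nat -> set U) N B :
  (forall n, (N <= n)%N -> F n = B) -> stable_value F = B.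
Proof.
move=> FB; rewrite /stable_value.
case: xgetP => [A _ /nearP[N' H]|/(_ B)]; last by case; apply/nearP; exists N.
by rewrite -(H (maxn N N')) ?leq_maxr // FB // leq_maxl.
Qed.

Section Quotients.
Variables (R : comPzRingType) (M : lmodType R) (MG : int -> set M).

Lemma ann_quot (N : set M) (sN : submodule N) x :
  ann (to_quotmod sN x) = colon N x.
Proof.
have E r : to_quotmod sN (r *: x) = 0 <-> N (r *: x).
  by rewrite -(linear0 (to_quotmod sN)); split=> [/to_quotmodP|?]; 
    [|apply/to_quotmodP]; rewrite subr0.
by apply/seteqP; split=> r; rewrite /ann /colon /= -linearZ => /E.
Qed.

(** Degrees of homogeneous elements of A/N whose annihilator satisfies [Q]: equality with [p] gives
    the local v-number, primality the global one. *)
Definition colon_degrees (A N : set M) (Q : set R -> Prop) : set int :=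
  [set k | exists x, [/\ A x, MG k x & Q (colon N x)]].

Lemma vloc_colon (A : set M) p :
  vloc MG A p = infimum +oo%E
    [set n%:E%E | n in colon_degrees A [set 0] (fun q => p = q)].
Proof.
congr (infimum _ (image _ _)); apply/seteqP.
by split=> k [x]; [case=> Ax Gx ->; exists x | case=> Ax Gx Ex; exists x].
Qed.

(** The infimum over primes of infima over degrees collapses to one minimum over homogeneous
    elements with prime annihilator. *)
Lemma vnum_fin (L : lmodType R) (LG : int -> set L) (A : set L) m :
  is_min [set k | exists x, [/\ A x, LG k x & prime_ideal (ann x)]] m ->
  vnum LG A = m%:E%E.
Proof.
move=> [[x [Ax Gx px]] mmin]; apply: infimum_eq.
  exists (ann x); first by split=> //; exists x.
  apply: infimum_fin; split; first by exists x.
  by move=> k [z [Az Gz] pz]; apply: mmin; exists z; split=> //; rewrite -pz.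
move=> _ [p [pp _] <-]; apply: infimum_fin_ge => k [z [Az Gz] pz].
by apply: mmin; exists z; split=> //; rewrite -pz.
Qed.

Lemma vnum_colon (A : set M) m :
  is_min (colon_degrees A [set 0] (@prime_ideal R)) m -> vnum MG A = m%:E%E.
Proof. exact: vnum_fin. Qed.

(** A class may be given by one representative in [A] and another in [MG k]; the latter is also in
    [A] because [N] is. *)
Lemma quotient_degrees (A N : set M) (sN : submodule N) (Q : set R -> Prop) k :
  submodule A -> N `<=` A ->
  (exists x, [/\ (to_quotmod sN @` A) x, quot_grading sN MG k x & Q (ann x)]) <->
  colon_degrees A N Q k.
Proof.
move=> sA NA; split=> [[_ [[a Aa <-] [h Gh]]]|[x [Ax Gx Qx]]].
  move=> E; rewrite -E ann_quot => Qh; exists h; split=> //.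
  by apply: (submoduleBK sA) Aa; apply: NA; apply/(to_quotmodP sN).
by exists (to_quotmod sN x); rewrite ann_quot; split=> //; exists x.
Qed.

Lemma to_quotmod_setT (N : set M) (sN : submodule N) :
  to_quotmod sN @` setT = setT.
Proof.
by apply/seteqP; split=> // z _; have [x <-] := to_quotmod_surj z; exists x.
Qed.

Lemma vloc_quotient (A N : set M) (sN : submodule N) p :
  submodule A -> N `<=` A ->
  vloc (quot_grading sN MG) (to_quotmod sN @` A) p =
  infimum +oo%E [set n%:E%E | n in colon_degrees A N (fun q => p = q)].
Proof.
move=> sA NA; congr (infimum _ (image _ _)); apply/seteqP; split=> k.
  move=> [x [Ax Gx] px]; apply/(quotient_degrees sN (fun q => p = q) k sA NA).
  by exists x.
move=> /(quotient_degrees sN (fun q => p = q) k sA NA)[x [Ax Gx px]].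
by exists x.
Qed.

Lemma vnum_quotient (A N : set M) (sN : submodule N) m :
  submodule A -> N `<=` A -> is_min (colon_degrees A N (@prime_ideal R)) m ->
  vnum (quot_grading sN MG) (to_quotmod sN @` A) = m%:E%E.
Proof.
move=> sA NA [Am mmin]; apply: vnum_fin; split.
  exact/(quotient_degrees sN (@prime_ideal R) m sA NA).
by move=> k /(quotient_degrees sN (@prime_ideal R) k sA NA); apply: mmin.
Qed.

Lemma Ass_quotient (A N : set M) (sN : submodule N) p :
  Ass (to_quotmod sN @` A) p <->
  prime_ideal p /\ exists2 x, A x & p = colon N x.
Proof.
split=> -[pp [x]]; first by case=> a Aa <-; rewrite ann_quot => pa; split=> //; exists a.
move=> Ax px; split=> //; exists (to_quotmod sN x); first by exists x.
by rewrite ann_quot.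
Qed.

End Quotients.

(** * Vasconcelos invariants *)

Section EventuallyLinear.
Variables (c : nat) (d : 'I_c -> nat).

Definition eventually_linear (A : nat -> set int) : Prop :=
  exists (i : 'I_c) (b : int) n0, forall n, (n0 <= n)%N ->
    is_min (A n) ((d i)%:Z * n%:Z + b).

Lemma linear_compare (a a' : nat) (b b' : int) : (a < a')%N \/ a = a' /\ b <= b' ->
  exists n0, forall n : nat, (n0 <= n)%N -> a%:Z * n%:Z + b <= a'%:Z * n%:Z + b'.
Proof.
move=> [aa'|[-> bb']]; last by exists 0%N => n _; rewrite lerD2l.
exists `|b - b'|%N => n bn.
have : (a.+1 * n <= a' * n)%N by rewrite leq_mul2r aa' orbT.
lia.
Qed.

Lemma eventually_linear_ext (A B : nat -> set int) n0 :
  (forall n, (n0 <= n)%N -> A n = B n) -> eventually_linear A -> eventually_linear B.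
Proof.
move=> AB [i [b [n1 H]]]; exists i, b, (maxn n0 n1) => n.
by rewrite geq_max => /andP[/AB <- /H].
Qed.

(** The smaller slope wins for large n, and the smaller intercept if the slopes agree. *)
Lemma eventually_linear_setU (A B : nat -> set int) :
  eventually_linear A -> eventually_linear B ->
  eventually_linear (fun n => A n `|` B n).
Proof.
have aux (A' B' : nat -> set int) i j (b b' : int) n0 n1 :
    ((d i < d j)%N \/ d i = d j /\ b <= b') ->
    (forall n, (n0 <= n)%N -> is_min (A' n) ((d i)%:Z * n%:Z + b)) ->
    (forall n, (n1 <= n)%N -> is_min (B' n) ((d j)%:Z * n%:Z + b')) ->
    eventually_linear (fun n => A' n `|` B' n).
  move=> /linear_compare[n2 H2] H0 H1; exists i, b, (maxn n0 (maxn n1 n2)) => n.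
  rewrite !geq_max => /and3P[/H0[An mA] /H1[_ mB] /H2 le]; split; first by left.
  by move=> k [/mA //|/mB]; apply: le_trans.
move=> [i [b [n0 H0]]] [j [b' [n1 H1]]].
have [ij|ji|ij] := ltngtP (d i) (d j).
- by apply: aux H0 H1; left.
- apply: (@eventually_linear_ext (fun n => B n `|` A n) _ 0) => [n _|].
    exact: setUC.
  by apply: aux H1 H0; left.
have [bb'|b'b] := leP b b'; first by apply: aux H0 H1; right.
apply: (@eventually_linear_ext (fun n => B n `|` A n) _ 0) => [n _|].
  exact: setUC.
by apply: aux H1 H0; right; split=> //; exact: ltW.
Qed.

Lemma eventually_linear_bigcup (J : eqType) (s : seq J) (A : J -> nat -> set int) :
  s != [::] -> (forall j, j \in s -> eventually_linear (A j)) ->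
  eventually_linear (fun n => [set k | exists2 j, j \in s & A j n k]).
Proof.
elim: s => // j s IH _ H.
have Hj := H j (mem_head _ _).
have [s0|/IH Hs] := eqVneq s [::].
  apply: (eventually_linear_ext (n0 := 0%N)) Hj => n _; rewrite s0.
  apply/seteqP; split=> k; first by exists j; rewrite ?mem_head.
  by move=> [i]; rewrite inE => /eqP ->.
have {}Hs : eventually_linear (fun n => [set k | exists2 j, j \in s & A j n k]).
  by apply: Hs => i si; apply: H; rewrite inE si orbT.
apply: (eventually_linear_ext (n0 := 0%N)) (eventually_linear_setU Hj Hs) => n _.
apply/seteqP; split=> k.
  move=> [Ak|[i si Ak]]; [by exists j; rewrite ?mem_head|exists i => //].
  by rewrite inE si orbT.
by move=> [i]; rewrite inE => /orP[/eqP ->|si Ak]; [left|right; exists i].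
Qed.

Lemma eventually_linear_shift (A : nat -> set int) :
  eventually_linear (fun n => A n.+1) -> eventually_linear A.
Proof.
move=> [i [b [n0 H]]]; exists i, (b - (d i)%:Z), n0.+1 => -[//|n] /H.
by congr is_min; lia.
Qed.

End EventuallyLinear.

(** * Comparison of M/I^nM with I^(n-1)M/I^nM and with (0 : I) *)

Section Main.
Variables (R : comPzRingType) (RG : nat -> set R).
Variables (M : lmodType R) (MG : int -> set M).
Variables (I : set R) (c : nat) (y : 'I_c -> R) (d : 'I_c -> nat).
Hypothesis R_graded : graded_ring RG.
Hypothesis R_noetherian : noetherian R.
Hypothesis M_graded : graded_module RG MG.
Hypothesis M_fg : finitely_generated [set: M].
Hypothesis y_homogeneous : forall i, RG (d i) (y i).
Hypothesis y_generates : I = ideal_generated (range y).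

Local Notation P := (@powmod R M I).
Local Notation zero_colon := (annihilated M I).
Local Notation degrees := (colon_degrees MG).

Let sP : forall n, submodule (P n) := @powmod_submodule R M I.
Let sZ : submodule zero_colon := @annihilated_submodule R M I.
Let hP := powmod_homogeneous R_graded M_graded M_fg y_homogeneous y_generates.
Let hZ := annihilated_homogeneous M_graded y_homogeneous y_generates.
Let h0 := set0_homogeneous M_graded.

Lemma prime_power_annihilator p n x :
  prime_ideal p -> p = colon (P n) x -> I `<=` p.
Proof.
move=> pp px; have [ip _ pM] := pp.
apply: (ideal_range_sub y_generates ip) => _ [i _ <-].
have pow k : P k (y i ^+ k *: x).
  elim: k => [|k IH]; first by rewrite powmod0.
  rewrite exprS -scalerA; apply: (powmod_in y_generates) => //.
  exact: (ideal_range_in y_generates).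
have : p (y i ^+ n) by rewrite px; apply: pow.
elim: n {px} => [|n IH]; first by case: pp => _ p1 _ /p1.
by rewrite exprS => /pM[].
Qed.

(* The witness comes from (I^(n+1)M : I) = I^n M + (0 : I). *)
Lemma associated_prime_step : exists n0, forall n, (n0 <= n)%N ->
  forall p k x, prime_ideal p -> MG k x -> p = colon (P n.+1) x ->
  exists x', [/\ P n x', MG k x', zero_colon (x - x') &
    ~ Ass zero_colon p -> p = colon (P n.+1) x'].
Proof.
have [n0 Hcolon] := powmod_colon R_noetherian M_fg y_generates.
have [n1 Hann] := powmod_annihilated R_noetherian M_fg y_generates.
exists (maxn n0 n1) => n; rewrite geq_max => /andP[n0n n1n] p k x pp Gx px.
have Ip := prime_power_annihilator pp px.
have [|x1 Px1 Zx1] := Hcolon n n0n x.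
  by move=> i; have := Ip _ (ideal_range_in y_generates i); rewrite px.
pose x' := component M_graded.1 x1 k.
have Zx' : zero_colon (x - x').
  have := hZ Zx1 k; rewrite componentD componentN.
  by rewrite (component_homog M_graded.1 k Gx) eqxx.
have Px' : P n x' by exact: hP.
exists x'; split=> //; first exact: component_in.
(* For [r] in [p], r(x - x') lies in both (0 : I) and I^nM, which meet in 0. *)
move=> nZp; have pz r : p r -> r *: x = r *: x'.
  move=> pr; apply/eqP; rewrite -subr_eq0 -scalerBr; apply/eqP.
  apply: (Hann n n1n); first exact: (submoduleZ _ sZ Zx').
  rewrite scalerBr; apply: (submoduleB (sP n)); last exact: submoduleZ (sP n) Px'.
  by apply: (powmod_decr1 y_generates); rewrite px in pr.
(* Otherwise [p] would be the annihilator of [x - x'], an element of (0 : I). *)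
have [s ps zs] : exists2 s, ~ p s & s *: x = s *: x'.
  apply: contrapT => no; apply: nZp; split=> //; exists (x - x') => //.
  apply/seteqP; split=> s; rewrite /ann /= scalerBr.
    by move=> /pz ->; rewrite subrr.
  by move=> /subr0_eq zs; apply: contrapT => ps; apply: no; exists s.
apply/seteqP; split=> r; rewrite /colon /=.
  by move=> pr; rewrite -pz //; rewrite px in pr.
move=> Pr; have : p (s * r).
  rewrite px /colon /= mulrC -scalerA zs scalerA mulrC -scalerA.
  exact: submoduleZ (sP _) Pr.
by case: pp => _ _ pM /pM[].
Qed.

Lemma step_prime_degrees : exists n0, forall n, (n0 <= n)%N -> forall p,
  prime_ideal p -> ~ Ass zero_colon p ->
  ((exists x, p = colon (P n.+1) x) -> step_primes M I n p) /\
  degrees setT (P n.+1) (fun q => p = q) = degrees (P n) (P n.+1) (fun q => p = q).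
Proof.
have [n0 H] := associated_prime_step; exists n0 => n n0n p pp nZp; split.
  move=> [x px].
  have [k [x' [_ Gx' px']]] := associated_prime_homog_elt R_graded (sP n.+1) (@hP n.+1)
    (@submodule_setT R M) (fun _ _ _ => Logic.I) Logic.I pp px.
  have [x'' [Px _ _ Ex]] := H n n0n p k x' pp Gx' px'.
  by split=> //; exists x'' => //; exact: Ex.
apply/seteqP; split=> k [x [_ Gx px]]; last by exists x.
have [x' [Px' Gx' _ Ex]] := H n n0n p k x pp Gx px.
by exists x'; split=> //; exact: Ex.
Qed.

Lemma calA_Ass p : calA M I p -> exists N, forall n, (N <= n)%N ->
  calA M I = Ass [set: Mquot M I n].
Proof.
move=> Ap; have [N H] := @stable_valueP _ (fun n => Ass [set: Mquot M I n]) p Ap.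
by exists N => n Nn; rewrite /calA -(H n Nn).
Qed.

Lemma Ass_Mquot n p : Ass [set: Mquot M I n] p <->
  prime_ideal p /\ exists x : M, p = colon (P n) x.
Proof.
rewrite -(to_quotmod_setT (sP n)); split.
  by move=> /Ass_quotient[pp [x _ px]]; split=> //; exists x.
by move=> [pp [x px]]; apply/Ass_quotient; split=> //; exists x.
Qed.

Lemma Ass_Mstep n : Ass (@Mstep R M I n.+1) = step_primes M I n.
Proof.
by apply/seteqP; split=> p; [exact: (Ass_quotient (P n) (sP n.+1) p).1 |
  exact: (Ass_quotient (P n) (sP n.+1) p).2].
Qed.

Lemma calA_calB p : calA M I p -> ~ Ass zero_colon p ->
  calB M I p /\ exists n0, forall n, (n0 <= n)%N -> step_primes M I n p.
Proof.
move=> Ap nZp; have [N HN] := calA_Ass Ap.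
have [n0 H0] := step_prime_degrees.
have step n : (maxn N n0 <= n)%N -> step_primes M I n p.
  rewrite geq_max => /andP[Nn n0n].
  have : Ass [set: Mquot M I n.+1] p by rewrite -HN // leqW.
  by move=> /Ass_Mquot[pp px]; apply: (H0 n n0n p pp nZp).1.
split; last by exists (maxn N n0).
have [n1 H1] := step_primes_stable R_noetherian M_fg y_generates.
have -> : calB M I = step_primes M I n1.
  apply: (@stable_value_eq _ _ n1.+1) => -[//|n] n1n.
  by rewrite Ass_Mstep; exact: H1.
by rewrite -(H1 (maxn n1 (maxn N n0))) ?leq_maxl //; apply/step/leq_maxr.
Qed.

Lemma calA_linear p : calA M I p -> ~ Ass zero_colon p ->
  eventually_linear d (fun n => degrees (P n) (P n.+1) (fun q => p = q)).
Proof.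
move=> Ap nZp; have [_ step] := calA_calB Ap nZp.
exact: (step_degrees_linear R_graded R_noetherian M_graded M_fg y_homogeneous y_generates step).
Qed.

Lemma vloc_stepE n p : vloc_step I MG n.+1 p = infimum +oo%E
  [set k%:E%E | k in degrees (P n) (P n.+1) (fun q => p = q)].
Proof. by apply: vloc_quotient; [exact: sP | exact: (powmod_decr1 y_generates)]. Qed.

Lemma vloc_quotE n p : vloc_quot I MG n p = infimum +oo%E
  [set k%:E%E | k in degrees setT (P n) (fun q => p = q)].
Proof.
rewrite /vloc_quot -(to_quotmod_setT (sP n)); apply: vloc_quotient => //.
exact: submodule_setT.
Qed.

Lemma vnum_quot_fin n m : is_min (degrees setT (P n) (@prime_ideal R)) m ->
  vnum_quot I MG n = m%:E%E.
Proof.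
move=> H; rewrite /vnum_quot -(to_quotmod_setT (sP n)).
by apply: vnum_quotient => //; exact: submodule_setT.
Qed.

Lemma vnum_step_fin n m : is_min (degrees (P n) (P n.+1) (@prime_ideal R)) m ->
  vnum_step I MG n.+1 = m%:E%E.
Proof. by apply: vnum_quotient; [exact: sP | exact: (powmod_decr1 y_generates)]. Qed.

Lemma vloc_eventually_linear p : calA M I p -> ~ Ass zero_colon p ->
  calB M I p /\ exists (i : 'I_c) (b : int), \forall n \near \oo,
    vloc_quot I MG n p = vloc_step I MG n p /\
    vloc_step I MG n p = ((d i)%:Z * n%:Z + b)%:E.
Proof.
move=> Ap nZp; have [Bp [n1 step]] := calA_calB Ap nZp; split=> //.
have [n0 H0] := step_prime_degrees.
have [pp _] := step n1 (leqnn _).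
(* [Mstep] at index [n.+1] is I^nM/I^(n+1)M, hence the shift; [set0] at index 0 is a dummy. *)
have [|i [b [n2 Hlin]]] := @eventually_linear_shift c d
  (fun n => if n is m.+1 then degrees (P m) (P m.+1) (fun q => p = q) else set0).
  exact: calA_linear.
exists i, b; apply/nearP; exists (maxn n2 n0.+1) => -[|n].
  by rewrite geq_max ltn0 andbF.
rewrite geq_max ltnS => /andP[n2n n0n].
rewrite vloc_stepE vloc_quotE (H0 n n0n p pp nZp).2; split=> //.
by apply: infimum_fin; exact: Hlin n2n.
Qed.

Lemma bounded_below : exists b : int, forall k x, MG k x -> x <> 0 -> b <= k.
Proof.
have [b Hb] := powmod_degree_bound (D := 0) R_graded M_graded M_fg y_homogeneous
  y_generates (fun=> leq0n _).
exists b => k x Gx x0; have := Hb 0%N k x; rewrite powmod0 mul0n addr0; exact.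
Qed.

Lemma prime_colon_neq0 (N : set M) x : submodule N -> prime_ideal (colon N x) -> x <> 0.
Proof.
by move=> sN [_ p1 _] x0; apply: p1; rewrite /colon /= x0 scaler0; exact: submodule0.
Qed.

Lemma degrees_min (A N : set M) (Q : set R -> Prop) k :
  submodule N -> Q `<=` @prime_ideal R -> degrees A N Q k ->
  exists m, is_min (degrees A N Q) m.
Proof.
move=> sN Qp Ak; have [b Hb] := bounded_below.
apply: is_min_exists Ak => j [x [_ Gx /Qp px]]; apply: Hb Gx _.
exact: prime_colon_neq0 px.
Qed.

(** For large n, (0 : I) embeds in M/I^nM, so annihilators do not change. *)
Lemma colon_powmod_annihilated : exists n0, forall n, (n0 <= n)%N ->
  forall z, zero_colon z -> colon (P n) z = ann z.
Proof.
have [n0 H] := powmod_annihilated R_noetherian M_fg y_generates.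
exists n0 => n n0n z Zz; apply/seteqP; split=> r; rewrite /colon /ann /=.
  by apply: H => //; exact: (submoduleZ _ sZ Zz).
by move=> ->; exact: submodule0 (sP n).
Qed.

(* I^(n-1)M lives in degrees at least n + b, so that it contributes nothing in low
   degrees. *)
Lemma low_degree_prime : (forall i, (1 <= d i)%N) -> forall v : int,
  exists n0, forall n, (n0 <= n)%N -> forall k x, k <= v -> MG k x ->
  prime_ideal (colon (P n) x) -> zero_colon x /\ colon (P n) x = ann x.
Proof.
move=> d1 v; have [n0 Hstep] := associated_prime_step.
have [n1 Hann] := colon_powmod_annihilated.
have [b Hb] := powmod_degree_bound R_graded M_graded M_fg y_homogeneous
  y_generates d1.
(* This makes b + n exceed [v], so a nonzero [x'] in I^nM of degree [k <= v] is impossible. *)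
exists (maxn n1 (n0 + `|v - b|).+2) => -[|n]; first by rewrite geq_max ltn0 andbF.
rewrite geq_max => /andP[n1n n0n] k x kv Gx pp.
have [|x' [Px' Gx' Zx _]] := Hstep n _ _ k x pp Gx erefl; first by lia.
have x'0 : x' = 0.
  by apply: contrapT => /(Hb n k x' Px' Gx'); rewrite mul1n; lia.
rewrite x'0 subr0 in Zx; by split=> //; exact: Hann.
Qed.

Lemma Ass_zero_colon_degree p : Ass zero_colon p ->
  exists v, is_min (degrees zero_colon [set 0] (fun q => p = q)) v.
Proof.
move=> [pp [z Zz pz]].
have [k [z' [Zz' Gz' pz']]] := associated_prime_homog_elt R_graded (@submodule_set0 R M)
  h0 sZ hZ Zz pp pz.
apply: (@degrees_min _ _ _ k); first exact: submodule_set0.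
  by move=> q <-.
by exists z'.
Qed.

Lemma vloc_eventually_constant p : Ass zero_colon p -> (forall i, (1 <= d i)%N) ->
  \forall n \near \oo, vloc_quot I MG n p = vloc MG setT p /\
    vloc MG setT p = vloc MG zero_colon p.
Proof.
move=> Zp d1; have [v [[z [Zz Gz pz]] vmin]] := Ass_zero_colon_degree Zp.
(* Hence every element of M with annihilator [p] already lies in (0 : I), which gives the second
   equality. *)
have [pp _] := Zp; have Ip : I `<=` p by move=> a /Zz az; rewrite pz.
have -> : vloc MG setT p = vloc MG zero_colon p.
  rewrite !vloc_colon; congr (infimum _ (image _ _)); apply/seteqP.
  split=> k [x [Ax Gx px]]; exists x; split=> // a /Ip.
  by rewrite px.
have [n0 H0] := low_degree_prime d1 v; have [n1 H1] := colon_powmod_annihilated.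
apply/nearP; exists (maxn n0 n1) => n; rewrite geq_max => /andP[n0n n1n].
split=> //; rewrite vloc_colon (infimum_fin (m := v)); last by split=> //; exists z.
rewrite vloc_quotE; apply: infimum_fin; split.
  by exists z; rewrite H1.
move=> k [x [_ Gx px]]; rewrite leNgt; apply/negP => kv.
have [|Zx Ex] := H0 n n0n k x (ltW kv) Gx; first by rewrite -px.
by move: kv; rewrite ltNge vmin //; exists x; split=> //; rewrite px Ex.
Qed.

(** A maximal annihilator is prime: if [b *: x] is nonzero, its annihilator contains that of [x] and
    so equals it. *)
Lemma Ass_nonempty (A : set M) : submodule A -> A <> [set 0] -> exists p, Ass A p.
Proof.
move=> sA A0; have [x0 Ax0 x00] : exists2 x, A x & x <> 0.
  apply: contrapT => no; apply: A0; apply/seteqP; split=> [x Ax|_ ->]; last exact: submodule0.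
  by apply: contrapT => x0; apply: no; exists x.
have s0 := @submodule_set0 R M.
have [m [x [Ax xn0 xmax]]] := @exists_maximal_colon R M R_noetherian
  (fun=> [set 0]) 0%N x0 (fun=> A) (fun=> s0) Ax0 x00.
exists (ann x); split; last by exists x.
split; first exact: (colon_ideal x s0).
  by rewrite /ann /= scale1r.
move=> a b ab; have [bx|bx] := pselect (b *: x = 0); first by right.
left; rewrite /ann /= -[_ = 0]/(colon [set 0] x a).
rewrite (xmax m (b *: x)) //; first by rewrite /colon /= scalerA.
  exact: submoduleZ.
by move=> r; rewrite /colon /= scalerA mulrC -scalerA => ->; rewrite scaler0.
Qed.

Lemma vnum_quot_zero_colon : zero_colon <> [set 0] ->
  (\forall n \near \oo, (vnum_quot I MG n <= vnum MG zero_colon)%E) /\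
  ((forall i, (1 <= d i)%N) ->
    \forall n \near \oo, vnum_quot I MG n = vnum MG zero_colon).
Proof.
move=> Z0; have [p Zp] := Ass_nonempty sZ Z0.
have [k0 [[z0 [Zz0 Gz0 pz0]] _]] := Ass_zero_colon_degree Zp.
have s0 := @submodule_set0 R M.
have [||v vmin] := @degrees_min zero_colon [set 0] (@prime_ideal R) k0 s0.
- by [].
- by exists z0; rewrite -pz0; split=> //; case: Zp.
rewrite (vnum_colon vmin); have [[z [Zz Gz pz]] lb] := vmin.
have [n1 H1] := colon_powmod_annihilated.
have Pv n : (n1 <= n)%N -> degrees setT (P n) (@prime_ideal R) v.
  by move=> n1n; exists z; rewrite H1.
split.
  apply/nearP; exists n1 => n n1n.
  have [|m mmin] := degrees_min (sP n) _ (Pv n n1n); first by [].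
  by rewrite (vnum_quot_fin mmin) lee_fin; apply/mmin.2/Pv.
move=> d1; have [n0 H0] := low_degree_prime d1 v.
apply/nearP; exists (maxn n0 n1) => n; rewrite geq_max => /andP[n0n n1n].
apply: vnum_quot_fin; split; first exact: Pv.
move=> k [x [_ Gx px]]; rewrite leNgt; apply/negP => kv.
have [Zx Ex] := H0 n n0n k x (ltW kv) Gx px.
by move: kv; rewrite ltNge lb //; exists x; split=> //; rewrite Ex in px.
Qed.

(** Now no prime is associated to (0 : I), so [calA] lies in the finite list [Q], and the v-number
    is a minimum of finitely many eventually linear functions. *)
Lemma vnum_eventually_linear : zero_colon = [set 0] -> calA M I !=set0 ->
  exists (i : 'I_c) (b : int), \forall n \near \oo,
    vnum_quot I MG n = vnum_step I MG n /\
    vnum_step I MG n = ((d i)%:Z * n%:Z + b)%:E.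
Proof.
move=> Z0 [p0 Ap0].
have nZ p : ~ Ass zero_colon p.
  rewrite Z0 => -[[_ p1 _] [_ -> px]]; apply: p1.
  by rewrite px /ann /= scaler0.
have [N HN] := calA_Ass Ap0.
have [Q HQ] := step_primes_finite R_noetherian M_fg y_generates.
have AQ p : calA M I p -> p \in Q.
  by move=> Ap; have [_ [n1 H]] := calA_calB Ap (nZ p); exact: HQ (H n1 (leqnn _)).
pose s := [seq p <- Q | `[< calA M I p >]].
have sE p : (p \in s) <-> calA M I p.
  rewrite mem_filter; split=> [/andP[/asboolP]|Ap]; first by [].
  by rewrite AQ // andbT; apply/asboolP.
have [n0 H0] := step_prime_degrees.
pose D n := degrees (P n) (P n.+1) (@prime_ideal R).
have primeA n x : (N <= n)%N -> prime_ideal (colon (P n) x) -> calA M I (colon (P n) x).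
  by move=> Nn pp; rewrite (HN n Nn); apply/Ass_Mquot; split=> //; exists x.
have linD : eventually_linear d D.
  apply: (@eventually_linear_ext _ _ (fun n => [set k | exists2 p, p \in s &
      degrees (P n) (P n.+1) (fun q => p = q) k]) _ N) => [n Nn|].
    apply/seteqP; split=> k.
      move=> [p /sE Ap [x [Px Gx px]]]; exists x; split=> //; rewrite -px.
      have : Ass [set: Mquot M I n.+1] p by rewrite -HN // leqW.
      by case.
    move=> [x [Px Gx px]]; exists (colon (P n.+1) x); last by exists x.
    by apply/sE/primeA => //; exact: leqW.
  apply: eventually_linear_bigcup => [|p /sE Ap]; last exact: calA_linear.
  by have /sE := Ap0; case: (s).
have quotD n : (maxn N n0 <= n)%N -> degrees setT (P n.+1) (@prime_ideal R) = D n.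
  rewrite geq_max => /andP[Nn n0n]; apply/seteqP; split=> k [x [Px Gx px]]; last by exists x.
  have : degrees setT (P n.+1) (fun q => colon (P n.+1) x = q) k by exists x.
  rewrite (H0 n n0n _ px (nZ _)).2 => -[x' [Px' Gx' Ex]].
  by exists x'; split=> //; rewrite -Ex.
have [|i [b [n2 Hlin]]] := @eventually_linear_shift c d
  (fun n => if n is m.+1 then D m else set0).
  exact: linD.
exists i, b; apply/nearP; exists (maxn n2 (maxn N n0).+1) => -[|n].
  by rewrite geq_max ltn0 andbF.
rewrite geq_max ltnS => /andP[n2n Nn].
have minD := Hlin n.+1 n2n.
by rewrite (vnum_step_fin minD); split=> //; apply: vnum_quot_fin; rewrite quotD.
Qed.

End Main.
Theorem theorem1p5
    (R : comPzRingType) (RG : nat -> set R)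
    (M : lmodType R) (MG : int -> set M)
    (I : set R) (c : nat) (y : 'I_c -> R) (d : 'I_c -> nat)
    (R_graded : graded_ring RG)
    (R_noetherian : noetherian R)
    (M_graded : graded_module RG MG)
    (M_fg : finitely_generated [set: M])
    (I_homogeneous : homogeneous_ideal RG I)
    (y_homogeneous : forall i, RG (d i) (y i))
    (y_generates : I = ideal_generated (range y)) :
  let zero_colon : set M := annihilated M I in
  [/\ forall p : set R, calA M I p -> ~ Ass zero_colon p ->
        calB M I p /\
        exists (i : 'I_c) (b : int), \forall n \near \oo,
          vloc_quot I MG n p = vloc_step I MG n p /\
          vloc_step I MG n p = ((d i)%:Z * n%:Z + b)%:E,
      forall p : set R, calA M I p -> Ass zero_colon p ->
        (forall i, (1 <= d i)%N) ->
        \forall n \near \oo,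
          vloc_quot I MG n p = vloc MG setT p /\
          vloc MG setT p = vloc MG zero_colon p,
      zero_colon <> [set 0] ->
        (\forall n \near \oo,
          (vnum_quot I MG n <= vnum MG zero_colon)%E) /\
        ((forall i, (1 <= d i)%N) ->
          \forall n \near \oo, vnum_quot I MG n = vnum MG zero_colon)
    & zero_colon = [set 0] -> calA M I !=set0 ->
        exists (i : 'I_c) (b : int), \forall n \near \oo,
          vnum_quot I MG n = vnum_step I MG n /\
          vnum_step I MG n = ((d i)%:Z * n%:Z + b)%:E].
Proof.
move=> zero_colon; split.
- exact: (vloc_eventually_linear R_graded R_noetherian M_graded M_fg y_homogeneous y_generates).
- move=> p _.
  exact: (vloc_eventually_constant R_graded R_noetherian M_graded M_fg y_homogeneous y_generates).
- exact: (vnum_quot_zero_colon R_graded R_noetherian M_graded M_fg y_homogeneous y_generates).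
- exact: (vnum_eventually_linear R_graded R_noetherian M_graded M_fg y_homogeneous y_generates).
Qed.
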